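(* Let $W$ be the additive white Gaussian noise channel with unit noise variance, i.e.\ $W(y|x)=\frac{1}{\sqrt{2\pi}}\exp\big(-\frac{(y-x)^2}{2}\big)$ for $x,y\in\mathbb{R}$, and let $M^*(W^n,\varepsilon,P)$ be the largest $M\in\mathbb{N}$ for which an $(n,M,\varepsilon,P)_{\mathrm{av}}$-code exists. For all $0<\varepsilon<1$ and $P\in(0,\infty)$, there is a constant $c$ (depending on $\varepsilon$ and $P$ but not on $n$) such that for all $n$, \[ \log M^*(W^n,\varepsilon,P) \ge n\,\mathsf{C}(P)+\sqrt{n\,\mathsf{V}(P)}\,\Phi^{-1}(\varepsilon)+\frac{1}{2}\log n + c, \] i.e.\ $\log M^*(W^n,\varepsilon,P) \ge n\mathsf{C}(P)+\sqrt{n\mathsf{V}(P)}\Phi^{-1}(\varepsilon)+\frac12\log n+O(1)$.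
   Context: Let $W^n(\mathbf{y}|\mathbf{x})=\prod_{i=1}^n W(y_i|x_i)$ for $\mathbf{x},\mathbf{y}\in\mathbb{R}^n$. An $(n,M,\varepsilon,P)_{\mathrm{av}}$-code is a collection $\{(\mathbf{x}(m),\mathcal{D}_m)\}_{m=1}^M$ of codewords $\mathbf{x}(m)\in\mathbb{R}^n$ satisfying the maximal power constraint $\|\mathbf{x}(m)\|_2^2\le nP$ for every $m$, and pairwise disjoint (measurable) decoding regions $\mathcal{D}_m\subset\mathbb{R}^n$, such that the average error probability satisfies $\frac{1}{M}\sum_{m=1}^M W^n(\mathcal{D}_m^c\,|\,\mathbf{x}(m))\le\varepsilon$. The capacity and dispersion functions are $\mathsf{C}(P)=\frac12\log(1+P)$ and $\mathsf{V}(P)=\log^2\mathrm{e}\cdot\frac{P(P+2)}{2(P+1)^2}$ (with logarithms to a common fixed base throughout). $\Phi$ is the standard Gaussian cumulative distribution function and $\Phi^{-1}$ its inverse. *)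

(* Defs.v *)
From HB Require Import structures.
From mathcomp Require Import all_boot all_order all_algebra.
From mathcomp Require Import all_classical all_reals all_analysis.
Set Implicit Arguments. Unset Strict Implicit. Unset Printing Implicit Defensive.
Import Order.TTheory GRing.Theory Num.Theory.
Import numFieldNormedType.Exports.
Local Open Scope classical_set_scope.
Local Open Scope ring_scope.

Section awgn.
Variable R : realType.

Definition W (y x : R) : R :=
  (Num.sqrt (2 * pi))^-1 * expR (- (y - x) ^+ 2 / 2).

(* W^n(D | x) for x in R^n (= n.-tuple R, with its product Borel
   sigma-algebra) and D a subset of R^n, as the iterated Lebesgue integral
   of 1_D(y) * prod_i W(y_i|x_i)  (first coordinate outermost). *)
Fixpoint Wn (n : nat) : n.-tuple R -> set (n.-tuple R) -> \bar R :=
  match n with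
  | 0 => fun _ D => ((\1_D [tuple]) : R)%:E
  | n'.+1 => fun x D =>
      (\int[@lebesgue_measure R]_(y in [set: R])
         ((W y (thead x))%:E *
          Wn (behead_tuple x) [set z | D (cons_tuple y z)]))%E
  end.

Definition sqnorm (n : nat) (x : n.-tuple R) : R :=
  \sum_(i < n) (tnth x i) ^+ 2.

Definition av_code (n M : nat) (eps P : R)
  (x : 'I_M -> n.-tuple R) (D : 'I_M -> set (n.-tuple R)) : Prop :=
  [/\ forall m, sqnorm (x m) <= n%:R * P,
      forall m, measurable (D m),
      forall m m', m != m' -> D m `&` D m' = set0 &
      (((M%:R)^-1)%:E * \sum_(m < M) Wn (x m) (~` D m) <= eps%:E)%E ].

Definition code_exists (n M : nat) (eps P : R) : Prop :=
  (0 < M)%N /\ exists x D, @av_code n M eps P x D.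

(* M*(W^n, eps, P): the largest M admitting a code (as a supremum in
   the extended reals, so that it is always defined). *)
Definition Mstar (n : nat) (eps P : R) : \bar R :=
  ereal_sup [set (M%:R)%:E | M in [set M | code_exists n M eps P]].

Definition logb (b x : R) : R := ln x / ln b.
Definition elogb (b : R) (x : \bar R) : \bar R :=
  match x with
  | r%:E => (logb b r)%:E
  | +oo%E => +oo%E
  | -oo%E => -oo%E
  end.

Definition Ccap (b P : R) : R := 2^-1 * logb b (1 + P).
Definition Vdisp (b P : R) : R :=
  (logb b (expR 1)) ^+ 2 * (P * (P + 2) / (2 * (P + 1) ^+ 2)).

Definition Phi (t : R) : R :=
  Rintegral (@lebesgue_measure R) `]-oo, t] (fun y => W y 0).
Definition Phiinv (e : R) : R := inf [set t | e <= Phi t].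

End awgn.

(* Main.v *)
(** Random coding with maximum likelihood decoding, the codewords being
    [sqrt(nP)] times the direction of independent Gaussian vectors. Split the
    output into its component [s] along the sent codeword and the orthogonal
    part, of norm [b]. The output is called atypical when [s <= tau b]. Otherwise
    a competitor wins with the probability of a spherical cap of slope [s/b],
    which is of order [n^(-1/2) (1 + (s/b)^2)^(-n/2)]; averaging over the noise
    gains another [n^(-1/2)], so that a competitor costs [O(1/n)]
    [(1 + tau^2)^(-n/2)] and one may take [M] of order
    [sqrt n (1 + tau^2)^(n/2)]. These two factors are the source of the term
    [1/2 log n].

    The laws of [s] and [b] come from rotation invariance and polar coordinates:
    [s - sqrt(nP)] is a standard normal variable and [b] is independent of it,
    with density proportional to [b^m exp(-b^2/2)], [m = n - 2]. Recentred at
    [sqrt m], this density is [exp(-t^2)] up to [O(1/sqrt m)], so the probability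
    of an atypical output is, up to [O(1/sqrt n)], the value of [Phi] at
    [(tau sqrt m - sqrt(nP)) / sqrt(1 + tau^2/2)]. Taking
    [tau = sqrt P + sqrt(1 + P/2) Phi^-1(eps) / sqrt n - O(1/n)] makes the total
    error at most [eps], and a Taylor expansion of [n/2 log(1 + tau^2)] gives the
    rate. *)

Require Import Defs.
From HB Require Import structures.
From mathcomp Require Import all_boot all_order all_algebra.
From mathcomp Require Import all_classical all_reals all_analysis.
From mathcomp Require Import measurable_realfun.
From mathcomp Require Import ring lra.
Set Implicit Arguments. Unset Strict Implicit. Unset Printing Implicit Defensive.
Import Order.TTheory GRing.Theory Num.Theory.
Import numFieldNormedType.Exports.
Local Open Scope classical_set_scope.
Local Open Scope ring_scope.

(** * Measurability and Tonelli *)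

(** An error of order [1/sqrt n] in probability moves the quantile by [O(1/sqrt n)], which the
    factor [sqrt n] turns into a bounded loss in [log M]. Both the total confusion and the error of
    the normal approximation are of that order, so the moments of the radial law are needed only up
    to constant factors: elementary inequalities compare them with each other, and no Gamma function
    is evaluated. Only the leading constant of the radial law must be exact, and comparing total
    masses supplies it. Gaussian directions stand for uniform points of the sphere because one
    rotation lemma then serves the noise and the competitors alike, and every measure on tuples is
    an iterated one-dimensional one. *)

Section measurability.
Context d (T : measurableType d) (R : realType).

Lemma measurable_fun_opp (f : T -> R) :
  measurable_fun setT f -> measurable_fun setT (fun x => - f x).
Proof. exact: measurableT_comp. Qed.

Lemma measurable_fun_normr (f : T -> R) :
  measurable_fun setT f -> measurable_fun setT (fun x => `|f x|).
Proof. exact: measurableT_comp. Qed.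

Lemma measurable_fun_expR (f : T -> R) :
  measurable_fun setT f -> measurable_fun setT (fun x => expR (f x)).
Proof. exact: measurableT_comp. Qed.

Lemma measurable_fun_sqrt (f : T -> R) :
  measurable_fun setT f -> measurable_fun setT (fun x => Num.sqrt (f x)).
Proof.
apply: measurableT_comp; apply: continuous_measurable_fun.
exact: sqrt_continuous.
Qed.

(** Inversion is not continuous at [0], so it is expressed through a real power of the nonnegative
    base [x ^+ 2]; the convention [0^-1 = 0] makes the identity hold at [0] too. *)
Lemma measurable_fun_inv (f : T -> R) :
  measurable_fun setT f -> measurable_fun setT (fun x => (f x)^-1).
Proof.
apply: (@measurableT_comp _ _ _ _ _ _ (fun x : R => x^-1)) => //.
have -> : (fun x : R => x^-1) = (fun x => x * (x ^+ 2) `^ (-1)).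
  apply/funext => x; rewrite powR_inv1 ?sqr_ge0//.
  have [->|x0] := eqVneq x 0; first by rewrite invr0 mul0r.
  by rewrite expr2 invfM mulrA divff ?mul1r.
apply: measurable_funM => //.
by apply: (measurableT_comp (measurable_powR _)) => //; exact: measurable_funX.
Qed.

Lemma measurable_fun_natr (f : T -> bool) :
  measurable_fun setT f -> measurable_fun setT (fun x => (f x)%:R : R).
Proof. by apply: (@measurableT_comp _ _ _ _ _ _ (fun b : bool => b%:R : R)). Qed.

Lemma measurable_fun_EFin (f : T -> R) :
  measurable_fun setT f -> measurable_fun setT (fun x => (f x)%:E).
Proof. by move=> ?; apply/measurable_EFinP. Qed.

End measurability.

Section tonelli.
Context d1 d2 (T1 : measurableType d1) (T2 : measurableType d2) (R : realType).
Local Open Scope ereal_scope.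

Lemma tonelli (m1 : {sigma_finite_measure set T1 -> \bar R})
    (m2 : {sigma_finite_measure set T2 -> \bar R}) (f : T1 -> T2 -> \bar R) :
  measurable_fun setT (fun p : T1 * T2 => f p.1 p.2) ->
  (forall x y, 0 <= f x y) ->
  \int[m1]_x \int[m2]_y f x y = \int[m2]_y \int[m1]_x f x y.
Proof.
move=> mf f0.
exact: (@fubini_tonelli _ _ _ _ _ m1 m2 (fun p => f p.1 p.2) mf (fun p => f0 _ _)).
Qed.

Lemma measurable_fun_integral (m2 : {sigma_finite_measure set T2 -> \bar R})
    (f : T1 -> T2 -> \bar R) :
  measurable_fun setT (fun p : T1 * T2 => f p.1 p.2) ->
  (forall x y, 0 <= f x y) ->
  measurable_fun setT (fun x => \int[m2]_y f x y).
Proof.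
move=> mf f0.
exact: (@measurable_fun_fubini_tonelli_F _ _ _ _ _ m2 (fun p => f p.1 p.2) mf
  (fun p => f0 _ _)).
Qed.

Lemma ge0_le_integralT (mu : {measure set T1 -> \bar R})
    (f g : T1 -> \bar R) :
  measurable_fun setT f -> measurable_fun setT g -> (forall x, 0 <= f x) ->
  (forall x, f x <= g x) -> \int[mu]_x f x <= \int[mu]_x g x.
Proof.
by move=> mf mg f0 fg; apply: ge0_le_integral.
Qed.

End tonelli.

Lemma measurable_fun2 d d1 d2 d3 (T : measurableType d) (T1 : measurableType d1)
    (T2 : measurableType d2) (T3 : measurableType d3) (h : T1 -> T2 -> T3)
    (f : T -> T1) (g : T -> T2) :
  measurable_fun setT (fun p : T1 * T2 => h p.1 p.2) ->
  measurable_fun setT f -> measurable_fun setT g ->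
  measurable_fun setT (fun x => h (f x) (g x)).
Proof.
move=> mh mf mg; apply: (measurableT_comp mh (g := fun x => (f x, g x))).
exact: measurable_fun_pair.
Qed.

Ltac meas1 :=
  lazymatch goal with
  | |- measurable_fun _ (fun x => x) => exact: measurable_id
  | |- measurable_fun _ id => exact: measurable_id
  | |- measurable_fun _ fst => exact: measurable_fst
  | |- measurable_fun _ snd => exact: measurable_snd
  | |- measurable_fun _ (fun _ => ?c) => exact: measurable_cst
  | |- measurable_fun _ (cst _) => exact: measurable_cst
  | |- measurable_fun _ (fun x => fst _) => apply: (measurableT_comp measurable_fst)
  | |- measurable_fun _ (fun x => snd _) => apply: (measurableT_comp measurable_snd)
  | |- measurable_fun _ (fun x => (_, _)) => apply: measurable_fun_pair
  | |- measurable_fun _ (fun x => (_ + _)%R) =>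
      first [apply: measurable_funD | apply: emeasurable_funD]
  | |- measurable_fun _ (fun x => (- _)%R) => apply: measurable_fun_opp
  | |- measurable_fun _ (fun x => (_ * _)%R) => apply: measurable_funM
  | |- measurable_fun _ (fun x => (_ ^+ _)%R) => apply: measurable_funX
  | |- measurable_fun _ (fun x => (`|_|)%R) => apply: measurable_fun_normr
  | |- measurable_fun _ (fun x => expR _) => apply: measurable_fun_expR
  | |- measurable_fun _ (fun x => Num.sqrt _) => apply: measurable_fun_sqrt
  | |- measurable_fun _ (fun x => GRing.inv _) => apply: measurable_fun_inv
  | |- measurable_fun _ (fun x => (_ <= _)%R) => apply: measurable_fun_ler
  | |- measurable_fun _ (fun x => (_ < _)%R) => apply: measurable_fun_ltr
  | |- measurable_fun _ (fun x => (_ == _)%R) => apply: measurable_fun_eqr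
  | |- measurable_fun _ (fun x => _ && _) => apply: measurable_and
  | |- measurable_fun _ (fun x => _ || _) => apply: measurable_or
  | |- measurable_fun _ (fun x => ~~ _) => apply: measurable_neg
  | |- measurable_fun _ (fun x => GRing.natmul _ (nat_of_bool _)) => apply: measurable_fun_natr
  | |- measurable_fun _ (fun x => EFin _) => apply: measurable_fun_EFin
  | |- measurable_fun _ (fun x => (_ + _)%E) => apply: emeasurable_funD
  | |- measurable_fun _ (fun x => (_ * _)%E) => apply: emeasurable_funM
  | |- measurable_fun _ (fun x => [tuple of _ :: _]) => apply: measurable_cons
  | |- measurable_fun _ (fun x => integral _ setT _) => apply: measurable_fun_integral
  end.
Ltac meas := repeat (first [eassumption | meas1]).

(** * Affine substitutions and densities *)

Section affine.
Variable R : realType.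
Local Notation leb := (@lebesgue_measure R).

(** Lebesgue measure is determined by its values on the intervals []p, q]], so only these are pulled
    back; for [a < 0] the preimage is closed at the other end. *)
Lemma lebesgue_measure_affine (a b : R) (A : set R) : a != 0 -> measurable A ->
  leb A = (`|a|%:E * leb ((fun x => a * x + b)%R @^-1` A))%E.
Proof.
move=> a0 mA.
have maff : @measurable_fun _ _ (measurableTypeR R) (measurableTypeR R) setT
    (fun x : R => a * x + b)%R by meas.
pose X : measurableTypeR R -> measurableTypeR R := fun x => (a * x + b)%R.
have /= := @lebesgue_measure_unique R
  (mscale (NngNum (normr_ge0 a)) (pushforward leb X)) _ A mA.
apply => _ [[p q]] /= _ <-.
rewrite /mscale /pushforward lebesgue_measure_itv /= !lte_fin.
transitivity (`|a|%:E * leb ((fun x : R => a * x + b)%R @^-1` `]p, q]))%E => //.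
have [a_gt0|a_le0] := ltP 0 a.
  have -> : (fun x : R => a * x + b) @^-1` `]p, q] = `](p - b) / a, (q - b) / a]%classic.
    apply/seteqP; split => x /=; rewrite !in_itv /=.
      by rewrite ltr_pdivrMr// ler_pdivlMr// ltrBlDr lerBrDr mulrC.
    by rewrite ltr_pdivrMr// ler_pdivlMr// ltrBlDr lerBrDr mulrC.
  rewrite lebesgue_measure_itv /= gtr0_norm// !lte_fin.
  rewrite ltr_pM2r ?invr_gt0// ltrD2r; case: ifP => _; last by rewrite mule0.
  by rewrite -!EFinB -EFinM; congr EFin; field.
have a_lt0 : a < 0 by rewrite lt_neqAle a0.
have -> : (fun x : R => a * x + b) @^-1` `]p, q] = `[(q - b) / a, (p - b) / a[%classic.
  apply/seteqP; split => x /=; rewrite !in_itv /=.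
    by rewrite ltr_ndivlMr// ler_ndivrMr// ltrBlDr lerBrDr mulrC andbC.
  by rewrite ltr_ndivlMr// ler_ndivrMr// ltrBlDr lerBrDr mulrC andbC.
rewrite lebesgue_measure_itv /= ltr0_norm// !lte_fin.
rewrite ltr_nM2r ?invr_lt0// ltrD2r; case: ifP => _; last by rewrite mule0.
by rewrite -!EFinB -EFinM; congr EFin; field.
Qed.

Local Open Scope ereal_scope.

Lemma integral_affine (a b : R) (f : R -> \bar R) : a != 0%R ->
  measurable_fun setT f -> (forall x, 0 <= f x) ->
  \int[leb]_x f (a * x + b)%R = (`|a|^-1)%:E * \int[leb]_x f x.
Proof.
move=> a0 mf f0.
have maff : @measurable_fun _ _ (measurableTypeR R) (measurableTypeR R) setT
    (fun x : R => a * x + b)%R by meas.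
pose X : measurableTypeR R -> measurableTypeR R := fun x => (a * x + b)%R.
pose nu : {measure set (measurableTypeR R) -> \bar R} :=
  mscale (NngNum (normr_ge0 a)) (pushforward leb X).
have -> : \int[leb]_x f x = \int[nu maff]_x f x.
  by apply: eq_measure_integral => A mA _; exact: lebesgue_measure_affine.
rewrite /nu ge0_integral_mscale//=.
rewrite (@ge0_integral_pushforward _ _ _ _ _ _ maff leb)//= muleA -EFinM.
by rewrite mulVf ?normr_eq0// mul1e preimage_setT.
Qed.

Lemma integral_scale (a : R) (f : R -> \bar R) : a != 0%R ->
  measurable_fun setT f -> (forall x, 0 <= f x) ->
  \int[leb]_x f (a * x)%R = (`|a|^-1)%:E * \int[leb]_x f x.
Proof.
move=> a0 mf f0; rewrite -(integral_affine 0 a0 mf f0).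
by apply: eq_integral => x _; rewrite addr0.
Qed.

Lemma integral_shift (b : R) (f : R -> \bar R) :
  measurable_fun setT f -> (forall x, 0 <= f x) ->
  \int[leb]_x f (x + b)%R = \int[leb]_x f x.
Proof.
move=> mf f0; have := integral_affine b (oner_neq0 R) mf f0.
rewrite normr1 invr1 mul1e => <-.
by apply: eq_integral => x _; rewrite mul1r.
Qed.

Lemma integral_opp (f : R -> \bar R) :
  measurable_fun setT f -> (forall x, 0 <= f x) ->
  \int[leb]_x f (- x)%R = \int[leb]_x f x.
Proof.
move=> mf f0; have := integral_scale (f := f) (a := -1) _ mf f0.
rewrite normrN1 invr1 mul1e => <-; last by rewrite oppr_eq0 oner_eq0.
by apply: eq_integral => x _; rewrite mulN1r.
Qed.

End affine.

Section density.
Context d (T : measurableType d) (R : realType).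
Local Open Scope ereal_scope.

Import HBNNSimple.

(** On an indicator the claim is [nuE]; linearity extends it to simple functions, and monotone
    convergence along [nnsfun_approx] to [f]. *)
Lemma integral_density (mu nu : {measure set T -> \bar R}) (g : T -> R) f :
  measurable_fun setT g -> (forall x, 0 <= g x)%R ->
  (forall A, measurable A -> nu A = \int[mu]_(x in A) (g x)%:E) ->
  measurable_fun setT f -> (forall x, 0 <= f x) ->
  \int[nu]_x f x = \int[mu]_x ((g x)%:E * f x).
Proof.
move=> mg g0 nuE mf f0.
have mg' : measurable_fun setT (fun x => (g x)%:E) by exact/measurable_EFinP.
pose h := nnsfun_approx measurableT mf.
have -> : \int[nu]_x f x = lim (\int[nu]_x (EFin \o h n) x @[n --> \oo]).
  have fE x : f x = lim ((EFin \o h n) x @[n --> \oo]).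
    by apply/esym/cvg_lim => //; exact: cvg_nnsfun_approx.
  under eq_integral => x _ do rewrite fE.
  apply: monotone_convergence => //.
  - by move=> n; exact/measurable_EFinP.
  - by move=> n x _ /=; rewrite lee_fin.
  - by move=> x _ a b ab; rewrite lee_fin; exact/lefP/nd_nnsfun_approx.
have -> : \int[mu]_x ((g x)%:E * f x) =
    lim (\int[mu]_x ((EFin \o h n) x * (g x)%:E) @[n --> \oo]).
  have fg x : (g x)%:E * f x = lim ((EFin \o h n) x * (g x)%:E @[n --> \oo]).
    by rewrite muleC; apply/esym/cvg_lim => //; apply: cvgeZr => //;
      exact: cvg_nnsfun_approx.
  under eq_integral => x _ do rewrite fg.
  apply: monotone_convergence => //.
  - by move=> n; apply/emeasurable_funM => //; exact/measurable_EFinP.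
  - by move=> n x _ /=; rewrite mule_ge0 ?lee_fin.
  - by move=> x _ a b ab/=; rewrite lee_wpmul2r ?lee_fin//; exact/lefP/nd_nnsfun_approx.
suff suf n : \int[mu]_x ((EFin \o h n) x * (g x)%:E) = \int[nu]_x (EFin \o h n) x.
  by under [in RHS]eq_fun do rewrite suf.
transitivity (\int[nu]_x
   (\sum_(y \in range (h n)) (y * \1_(h n @^-1` [set y]) x)%:E)); last first.
  by apply: eq_integral => t _; rewrite /= fimfunE -fsumEFin.
have indich m r : measurable_fun setT (fun x => (r * \1_(h m @^-1` [set r]) x)%:E).
  by apply/measurable_EFinP; exact: measurable_funM.
rewrite ge0_integral_fsum//; last by move=> m y _; exact: nnfun_muleindic_ge0.
transitivity (\int[mu]_x (\sum_(y \in range (h n))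
    (y * \1_(h n @^-1` [set y]) x)%:E * (g x)%:E)).
  under [RHS]eq_integral => x xE.
    rewrite -ge0_mule_fsuml => [|y]; last exact: nnfun_muleindic_ge0.
    rewrite fsumEFin // -(fimfunE _ x); over.
  by [].
rewrite ge0_integral_fsum//; last 2 first.
  - by move=> y; apply: emeasurable_funM.
  - move=> m y _; apply: mule_ge0; last by rewrite lee_fin.
    exact: nnfun_muleindic_ge0.
apply: eq_fsbigr => r rhn.
under [RHS]eq_integral do rewrite EFinM.
rewrite integralZl_indic_nnsfun => //.
under eq_integral do rewrite EFinM -muleA.
rewrite ge0_integralZl//.
- rewrite integral_indic// setIT nuE// [in RHS]integral_mkcond.
  congr (_ * _); apply: eq_integral => x _.
  by rewrite patchE indicE; case: ifP => _; rewrite ?mul1e ?mul0e.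
- by apply: emeasurable_funM => //; exact/measurable_EFinP.
- by move=> t Et; rewrite mule_ge0 ?lee_fin.
- by move: rhn; rewrite inE => -[t _ <-]; rewrite lee_fin.
Qed.

End density.

(** * Standard Gaussian measures *)

Section standard_normal.
Variable R : realType.
Local Open Scope ereal_scope.

(* [normal_prob] lives on [measurableTypeR R]; this copy lives on [R], as the
   tuples of the statement do. *)
Definition stdnormal : set R -> \bar R := normal_prob (0 : R) 1.

Let stdnormal0 : stdnormal set0 = 0.
Proof. exact: (measure0 (normal_prob (0 : R) 1)). Qed.

Let stdnormal_ge0 A : 0 <= stdnormal A.
Proof. exact: (measure_ge0 (normal_prob (0 : R) 1)). Qed.

Let stdnormal_sigma_additive : semi_sigma_additive stdnormal.
Proof. exact: (@measure_semi_sigma_additive _ _ _ (normal_prob (0 : R) 1)). Qed.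

HB.instance Definition _ := isMeasure.Build _ R R stdnormal
  stdnormal0 stdnormal_ge0 stdnormal_sigma_additive.

Let stdnormal_setT : stdnormal [set: R] = 1.
Proof. exact: (@probability_setT _ _ _ (normal_prob (0 : R) 1)). Qed.

HB.instance Definition _ := Measure_isProbability.Build _ R R stdnormal
  stdnormal_setT.

Lemma normal_pdf01E (x : R) : normal_pdf 0 1 x = W x 0.
Proof.
rewrite /normal_pdf oner_eq0 /normal_peak /normal_fun /W /= expr1n mul1r.
by rewrite -(mulr_natr pi) (mulrC pi).
Qed.

Lemma W_ge0 (x y : R) : (0 <= W x y)%R.
Proof. by rewrite mulr_ge0 ?expR_ge0// invr_ge0. Qed.

Lemma WE (x y : R) : W x y = W (x - y) 0.
Proof. by rewrite /W subr0. Qed.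

Lemma measurable_fun_W d (T : measurableType d) (f g : T -> R) :
  measurable_fun setT f -> measurable_fun setT g ->
  measurable_fun setT (fun x => W (f x) (g x)).
Proof. by move=> mf mg; rewrite /W; meas. Qed.

Lemma integral_stdnormal (f : R -> \bar R) :
  measurable_fun setT f -> (forall x, 0 <= f x) ->
  \int[stdnormal]_x f x = \int[lebesgue_measure]_x ((W x 0)%:E * f x).
Proof.
move=> mf f0.
have mid : @measurable_fun _ _ (measurableTypeR R) R setT (fun x => x) by meas.
transitivity (\int[pushforward (normal_prob (0 : R) 1)
  (fun x : measurableTypeR R => x : R)]_x f x) => //.
rewrite (@ge0_integral_pushforward _ _ _ _ _ _ mid)// preimage_setT.
apply: (@integral_density _ _ _ lebesgue_measure (normal_prob (0 : R) 1) (fun x => W x 0)) => //.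
- by rewrite /W; meas.
- by move=> x; exact: W_ge0.
- by move=> A mA; apply: eq_integral => x _; rewrite normal_pdf01E.
Qed.

End standard_normal.

Section gauss.
Variable R : realType.
Local Open Scope ereal_scope.

Definition consf n (p : R * n.-tuple R) : n.+1.-tuple R := [tuple of p.1 :: p.2].

Lemma measurable_consf n : measurable_fun setT (@consf n).
Proof. by apply: measurable_cons; meas. Qed.

Section step.
Variables (n : nat) (Q : probability (n.-tuple R) R).

Definition gauss_step : set (n.+1.-tuple R) -> \bar R :=
  pushforward (@stdnormal R \x Q) (@consf n).

Let gauss_step0 : gauss_step set0 = 0.
Proof. by rewrite /gauss_step /pushforward preimage_set0 measure0. Qed.

Let gauss_step_ge0 A : 0 <= gauss_step A.
Proof. exact: (measure_ge0 (@stdnormal R \x Q)). Qed.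

Let gauss_step_sigma_additive : semi_sigma_additive gauss_step.
Proof.
apply: (@measure_semi_sigma_additive _ _ _ (pushforward (@stdnormal R \x Q) (@consf n))).
exact: measurable_consf.
Qed.

HB.instance Definition _ := isMeasure.Build _ _ _ gauss_step
  gauss_step0 gauss_step_ge0 gauss_step_sigma_additive.

Let gauss_step_setT : gauss_step setT = 1.
Proof. by rewrite /gauss_step /pushforward preimage_setT probability_setT. Qed.

HB.instance Definition _ := Measure_isProbability.Build _ _ _ gauss_step
  gauss_step_setT.

End step.

(** The recursion peels off the first coordinate as [Wn] does, so that the two can be compared by
    induction; the bundled [probability] is what the product measure of the next step requires. *)
Fixpoint gauss (n : nat) : probability (n.-tuple R) R :=
  match n with
  | 0 => [the probability _ _ of dirac ([tuple] : 0.-tuple R)]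
  | n'.+1 => [the probability _ _ of gauss_step (gauss n')]
  end.

Lemma integral_gauss0 (f : 0.-tuple R -> \bar R) : measurable_fun setT f ->
  \int[gauss 0]_z f z = f [tuple].
Proof. by move=> mf; rewrite integral_dirac// diracT mul1e. Qed.

Lemma integral_gaussS n (f : n.+1.-tuple R -> \bar R) :
  measurable_fun setT f -> (forall z, 0 <= f z) ->
  \int[gauss n.+1]_z f z =
  \int[@stdnormal R]_u \int[gauss n]_z f [tuple of u :: z].
Proof.
move=> mf f0.
rewrite /= /gauss_step ge0_integral_pushforward//=; last exact: measurable_consf.
rewrite preimage_setT fubini_tonelli1//=.
by apply: measurableT_comp => //; exact: measurable_consf.
Qed.

Lemma integral_prob_cst d (T : measurableType d) (P : probability T R) (c : \bar R) :
  \int[P]_x c = c.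
Proof.
rewrite integral_cst; last by [].
by rewrite -[RHS]mule1; congr (_ * _); exact: probability_setT.
Qed.

End gauss.
Arguments gauss {R} n.
Arguments stdnormal {R}.

(** * Rotation invariance *)

Section rotation.
Variable R : realType.
Local Notation leb := (@lebesgue_measure R).
Local Open Scope ereal_scope.

(** The rotation is factored into two affine substitutions in one variable: at fixed [u],
    [v = (r p - a u) / b], so that [a u + b v = r p]; then at fixed [p], [u = (b q + a p) / r]. The
    Jacobians [r / b] and [b / r] cancel. *)
Lemma lebesgue_rotation (K : R -> R -> \bar R) (a b : R) : b != 0%R ->
  measurable_fun setT (fun p : R * R => K p.1 p.2) ->
  (forall q p, 0 <= K q p) ->
  \int[leb]_u \int[leb]_v K (u ^+ 2 + v ^+ 2)%R (a * u + b * v)%R =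
  \int[leb]_u \int[leb]_v K (u ^+ 2 + v ^+ 2)%R (Num.sqrt (a ^+ 2 + b ^+ 2) * u)%R.
Proof.
move=> b0 mK K0; set r := Num.sqrt _.
have r2 : (r ^+ 2 = a ^+ 2 + b ^+ 2)%R by rewrite sqr_sqrtr// addr_ge0// sqr_ge0.
have r0 : (r != 0)%R.
  rewrite -sqrf_eq0 r2 gt_eqF// ltr_wpDl ?sqr_ge0//.
  by rewrite lt_neqAle sqr_ge0 eq_sym sqrf_eq0 b0.
have rb0 : (r / b != 0)%R by rewrite mulf_neq0 ?invr_neq0.
have br0 : (b / r != 0)%R by rewrite mulf_neq0 ?invr_neq0.
have key p q : ((b / r * q + a * p / r) ^+ 2 +
    (r / b * p + - (a * (b / r * q + a * p / r) / b)) ^+ 2 = p ^+ 2 + q ^+ 2)%R.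
  have -> : (r / b * p + - (a * (b / r * q + a * p / r) / b) =
     ((r ^+ 2 - a ^+ 2) * p - a * b * q) / (r * b))%R.
    by field; rewrite b0 r0.
  transitivity ((a ^+ 2 + b ^+ 2) * (p ^+ 2 + q ^+ 2) / r ^+ 2)%R.
    by rewrite {1}r2; field; rewrite b0 r0.
  by rewrite -r2 mulrAC divff ?mul1r// sqrf_eq0.
transitivity (\int[leb]_u \int[leb]_p (`|r / b|%:E *
    K (u ^+ 2 + (r / b * p + - (a * u / b)) ^+ 2)%R (r * p)%R)).
  apply: eq_integral => u _.
  rewrite ge0_integralZl//; last by apply: (measurable_fun2 mK); meas.
  have := @integral_affine R (r / b) (- (a * u / b))
    (fun v => K (u ^+ 2 + v ^+ 2)%R (a * u + b * v)%R) rb0.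
  rewrite (_ : (fun x => K (u ^+ 2 + (r / b * x - a * u / b) ^+ 2)
    (a * u + b * (r / b * x - a * u / b)))%R = (fun p =>
    K (u ^+ 2 + (r / b * p - a * u / b) ^+ 2)%R (r * p)%R)); last first.
    by apply/funext => p; congr (K _ _); field.
  move=> ->//; last by apply: (measurable_fun2 mK); meas.
  by rewrite muleA -EFinM divff ?normr_eq0// mul1e.
rewrite tonelli; last first.
- by move=> u p; rewrite mule_ge0.
- by apply: emeasurable_funM; [meas|apply: (measurable_fun2 mK); meas].
apply: eq_integral => p _.
rewrite ge0_integralZl//; last by apply: (measurable_fun2 mK); meas.
have -> : \int[leb]_q K (p ^+ 2 + q ^+ 2)%R (r * p)%R = (`|b / r|^-1)%:E *
    \int[leb]_u K (u ^+ 2 + (r / b * p + - (a * u / b)) ^+ 2)%R (r * p)%R.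
  rewrite -(@integral_affine R (b / r) (a * p / r)
    (fun u => K (u ^+ 2 + (r / b * p + - (a * u / b)) ^+ 2)%R (r * p)%R))//.
    by apply: eq_integral => q _; rewrite key.
  by apply: (measurable_fun2 mK); meas.
by rewrite -normfV invf_div.
Qed.

Lemma stdnormal_opp (f : R -> \bar R) :
  measurable_fun setT f -> (forall x, 0 <= f x) ->
  \int[stdnormal]_x f (- x)%R = \int[stdnormal]_x f x.
Proof.
move=> mf f0.
have mW : measurable_fun setT (fun x : R => W x 0) by rewrite /W; meas.
rewrite !integral_stdnormal//; last by apply: measurableT_comp => //; meas.
rewrite -[RHS]integral_opp; last 2 first.
- by apply: emeasurable_funM; meas.
- by move=> x; rewrite mule_ge0// lee_fin W_ge0.
by apply: eq_integral => x _; rewrite /W !subr0 sqrrN.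
Qed.

Lemma integral_stdnormal2 (f : R -> R -> \bar R) :
  measurable_fun setT (fun p : R * R => f p.1 p.2) -> (forall x y, 0 <= f x y) ->
  \int[stdnormal]_u \int[stdnormal]_v f u v =
  \int[leb]_u \int[leb]_v (((2 * pi)^-1 * expR (- (u ^+ 2 + v ^+ 2) / 2))%:E * f u v).
Proof.
move=> mf f0.
have mW : measurable_fun setT (fun x : R => W x 0) by rewrite /W; meas.
rewrite integral_stdnormal; last 2 first.
- exact: measurable_fun_integral.
- by move=> x; exact: integral_ge0.
apply: eq_integral => u _.
have mfu : measurable_fun setT (f u) by apply: (measurable_fun2 mf); meas.
rewrite integral_stdnormal// -ge0_integralZl//; last 3 first.
- by apply: emeasurable_funM => //; meas.
- by move=> x _; rewrite mule_ge0// lee_fin W_ge0.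
- by rewrite lee_fin W_ge0.
apply: eq_integral => v _; rewrite muleA -EFinM; congr (_%:E * _).
rewrite /W !subr0 mulrACA -expRD -invfM -expr2 sqr_sqrtr.
  by congr (_ * expR _)%R; field.
by rewrite mulr_ge0// pi_ge0.
Qed.

Lemma stdnormal_rotation (h : R -> R -> \bar R) (a b : R) :
  measurable_fun setT (fun p : R * R => h p.1 p.2) ->
  (forall q p, 0 <= h q p) ->
  \int[stdnormal]_u \int[stdnormal]_v h (u ^+ 2 + v ^+ 2)%R (a * u + b * v)%R =
  \int[stdnormal]_u \int[stdnormal]_v
    h (u ^+ 2 + v ^+ 2)%R (Num.sqrt (a ^+ 2 + b ^+ 2) * u)%R.
Proof.
move=> mh h0.
(* [lebesgue_rotation] divides by [b]. When [b = 0] only the sign of [a] remains, and the symmetry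
   of the Gaussian removes it. *)
have [->|b0] := eqVneq b 0%R.
  rewrite expr0n addr0 sqrtr_sqr.
  under eq_integral do under eq_integral do rewrite mul0r addr0.
  have [a0|a0] := ltP a 0%R; last by rewrite ger0_norm.
  rewrite (ltr0_norm a0) -stdnormal_opp; last 2 first.
  - apply: measurable_fun_integral; last by move=> *; exact: h0.
    by apply: (measurable_fun2 mh); meas.
  - by move=> x; apply: integral_ge0.
  by apply: eq_integral => u _; apply: eq_integral => v _; rewrite sqrrN mulrNN.
rewrite [LHS]integral_stdnormal2; last 2 first.
- by apply: (measurable_fun2 mh); meas.
- by move=> u v; exact: h0.
rewrite [RHS]integral_stdnormal2; last 2 first.
- by apply: (measurable_fun2 mh); meas.
- by move=> u v; exact: h0.
apply: (@lebesgue_rotation (fun q p => ((2 * pi)^-1 * expR (- q / 2))%:E * h q p)) => //.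
- by apply: emeasurable_funM => //; meas.
- move=> q p; rewrite mule_ge0// lee_fin mulr_ge0 ?expR_ge0// invr_ge0.
  by rewrite mulr_ge0// pi_ge0.
Qed.

End rotation.

(** * Inner products and norms of tuples *)

Section inner_products.
Variable R : realType.

Definition inner n (x y : n.-tuple R) : R := \sum_(i < n) tnth x i * tnth y i.

Lemma sqnorm_cons n u (z : n.-tuple R) :
  sqnorm [tuple of u :: z] = u ^+ 2 + sqnorm z.
Proof.
rewrite /sqnorm big_ord_recl tnth0; congr (_ + _).
by apply: eq_bigr => i _; rewrite tnthS.
Qed.

Lemma inner_cons n u v (z w : n.-tuple R) :
  inner [tuple of u :: z] [tuple of v :: w] = u * v + inner z w.
Proof.
rewrite /inner big_ord_recl !tnth0; congr (_ + _).
by apply: eq_bigr => i _; rewrite !tnthS.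
Qed.

Lemma sqnorm_nil (z : 0.-tuple R) : sqnorm z = 0.
Proof. by rewrite /sqnorm big_ord0. Qed.

Lemma inner_nil (z w : 0.-tuple R) : inner z w = 0.
Proof. by rewrite /inner big_ord0. Qed.

Lemma sqnorm_ge0 n (z : n.-tuple R) : 0 <= sqnorm z.
Proof. by apply: sumr_ge0 => i _; exact: sqr_ge0. Qed.

Lemma innerC n (x y : n.-tuple R) : inner x y = inner y x.
Proof. by apply: eq_bigr => i _; rewrite mulrC. Qed.

Lemma innerxx n (x : n.-tuple R) : inner x x = sqnorm x.
Proof. by []. Qed.

Definition addt n (x y : n.-tuple R) : n.-tuple R :=
  [tuple tnth x i + tnth y i | i < n].

Definition scalet n (c : R) (x : n.-tuple R) : n.-tuple R :=
  [tuple c * tnth x i | i < n].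

Lemma inner_addtr n (x y z : n.-tuple R) :
  inner x (addt y z) = inner x y + inner x z.
Proof.
rewrite /inner -big_split; apply: eq_bigr => i _ /=.
by rewrite tnth_mktuple mulrDr.
Qed.

Lemma inner_scaletl n c (x y : n.-tuple R) : inner (scalet c x) y = c * inner x y.
Proof.
by rewrite /inner mulr_sumr; apply: eq_bigr => i _; rewrite tnth_mktuple mulrA.
Qed.

Lemma inner_scaletr n c (x y : n.-tuple R) : inner x (scalet c y) = c * inner x y.
Proof. by rewrite innerC inner_scaletl innerC. Qed.

Lemma sqnorm_scalet n c (x : n.-tuple R) : sqnorm (scalet c x) = c ^+ 2 * sqnorm x.
Proof. by rewrite -!innerxx inner_scaletl inner_scaletr mulrA. Qed.

Lemma sqnorm_addt n (x y : n.-tuple R) :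
  sqnorm (addt x y) = sqnorm x + 2 * inner x y + sqnorm y.
Proof.
rewrite -[LHS]innerxx inner_addtr ![inner (addt _ _) _]innerC !inner_addtr.
by rewrite !innerxx (innerC y x); ring.
Qed.

Section meas.
Context d (T : measurableType d) (n : nat).
Implicit Types f g : T -> n.-tuple R.

Lemma measurable_fun_tnth f i :
  measurable_fun setT f -> measurable_fun setT (fun x => tnth (f x) i).
Proof.
apply: (@measurableT_comp _ _ _ _ _ _ (fun z : n.-tuple R => tnth z i)).
exact: measurable_tnth.
Qed.

Lemma measurable_fun_inner f g : measurable_fun setT f -> measurable_fun setT g ->
  measurable_fun setT (fun x => inner (f x) (g x)).
Proof.
move=> mf mg; apply: measurable_sum => i.
by apply: measurable_funM; exact: measurable_fun_tnth.
Qed.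

Lemma measurable_fun_sqnorm f : measurable_fun setT f ->
  measurable_fun setT (fun x => sqnorm (f x)).
Proof. by move=> mf; apply: measurable_fun_inner. Qed.

Lemma measurable_fun_addt f g : measurable_fun setT f -> measurable_fun setT g ->
  measurable_fun setT (fun x => addt (f x) (g x)).
Proof.
move=> mf mg; apply/measurable_fun_tnthP => i.
rewrite (_ : _ \o _ = fun x => tnth (f x) i + tnth (g x) i).
  by apply: measurable_funD; exact: measurable_fun_tnth.
by apply/funext => x /=; rewrite tnth_mktuple.
Qed.

Lemma measurable_fun_scalet (c : T -> R) f :
  measurable_fun setT c -> measurable_fun setT f ->
  measurable_fun setT (fun x => scalet (c x) (f x)).
Proof.
move=> mc mf; apply/measurable_fun_tnthP => i.
rewrite (_ : _ \o _ = fun x => c x * tnth (f x) i).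
  by apply: measurable_funM => //; exact: measurable_fun_tnth.
by apply/funext => x /=; rewrite tnth_mktuple.
Qed.

End meas.
End inner_products.

Section radial_weight.
Variable R : realType.

Definition radw (m : nat) (a : R) : R := `|a| ^+ m * expR (- a ^+ 2 / 2).

Lemma radw_ge0 m a : 0 <= radw m a.
Proof. by rewrite mulr_ge0 ?expR_ge0// exprn_ge0. Qed.

Lemma measurable_fun_radw d (T : measurableType d) m (f : T -> R) :
  measurable_fun setT f -> measurable_fun setT (fun x => radw m (f x)).
Proof. by move=> mf; rewrite /radw; meas. Qed.

End radial_weight.

Ltac pos := intros; lazymatch goal with
  | |- is_true (@Order.le _ _ _ (EFin _)) => rewrite lee_fin; pos
  | |- is_true (@Order.le _ _ _ (_ * _)%E) => apply: mule_ge0; pos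
  | |- is_true (@Order.le _ _ _ (_ + _)%E) => apply: adde_ge0; pos
  | |- is_true (@Order.le _ _ _ (integral _ _ _)) => apply: integral_ge0; pos
  | |- is_true (@Order.le _ _ _ (_ + _)%R) => apply: addr_ge0; pos
  | |- is_true (@Order.le _ _ _ (_ * _)%R) => apply: mulr_ge0; pos
  | |- is_true (@Order.le _ _ _ (_ ^+ 2)%R) => apply: sqr_ge0
  | |- is_true (@Order.le _ _ _ (_ ^+ _)%R) => apply: exprn_ge0; pos
  | |- is_true (@Order.le _ _ _ (GRing.inv _)%R) => rewrite invr_ge0; pos
  | |- is_true (@Order.le _ _ _ (expR _)%R) => apply: expR_ge0
  | |- is_true (@Order.le _ _ _ (W _ _)%R) => apply: W_ge0
  | |- is_true (@Order.le _ _ _ (radw _ _)%R) => apply: radw_ge0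
  | |- is_true (@Order.le _ _ _ (Num.sqrt _)%R) => apply: sqrtr_ge0
  | |- is_true (@Order.le _ _ _ (`|_|)%R) => apply: normr_ge0
  | |- is_true (@Order.le _ _ _ pi) => apply: pi_ge0
  | |- is_true (@Order.le _ _ _ (_ %:R)%R) => apply: ler0n
  | |- is_true (@Order.le _ _ _ (sqnorm _)%R) => apply: sqnorm_ge0
  | |- _ => first [done | by apply: ltW | match goal with H : _ |- _ => by apply: H end]
  end.

Ltac meast := repeat (first [eassumption | lazymatch goal with
  | |- measurable_fun _ (fun x => integral _ setT _) =>
      apply: measurable_fun_integral; [idtac|solve [pos]]
  | |- measurable_fun _ (fun x => sqnorm _) => apply: measurable_fun_sqnorm
  | |- measurable_fun _ (@sqnorm _ _) => apply: measurable_fun_sqnorm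
  | |- measurable_fun _ (fun x => inner _ _) => apply: measurable_fun_inner
  | |- measurable_fun _ (fun x => addt _ _) => apply: measurable_fun_addt
  | |- measurable_fun _ (fun x => scalet _ _) => apply: measurable_fun_scalet
  | |- measurable_fun _ (fun x => W _ _) => apply: measurable_fun_W
  | |- measurable_fun _ (fun x => radw _ _) => apply: measurable_fun_radw
  end | meas1 | match goal with
  | H : measurable_fun setT ?F |- measurable_fun _ (fun x => ?F _) =>
      apply: (measurableT_comp H)
  | H : measurable_fun setT (fun p => ?h p.1 p.2) |- measurable_fun _ (fun x => ?h _ _) =>
      apply: (measurable_fun2 H)
  | |- measurable_fun ?D ?f => lazymatch f with
      | (fun _ => _) => fail
      | _ => change (measurable_fun D (fun x => f x))
      end
  end]).

(* Discharges the measurability and nonnegativity side conditions, and leaves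
   equations and inequalities between integrals alone. *)
Ltac side := lazymatch goal with
  | |- _ = _ => idtac
  | |- measurable _ => try by []
  | |- measurable_fun _ _ => try solve [meast]
  | |- _ => try solve [pos]
  end.

Section gauss_inner.
Variable R : realType.
Local Open Scope ereal_scope.

(* Rotation invariance: only the component of [z] along [y] matters. *)
Lemma integral_gauss_inner n (y : n.+1.-tuple R) (h : R -> R -> \bar R) :
  measurable_fun setT (fun p : R * R => h p.1 p.2) ->
  (forall q p, 0 <= h q p) ->
  \int[gauss n.+1]_z h (sqnorm z) (inner z y) =
  \int[stdnormal]_u \int[gauss n]_z
    h (u ^+ 2 + sqnorm z)%R (Num.sqrt (sqnorm y) * u)%R.
Proof.
elim: n y h => [|n IHn] y h mh h0.
  case/tupleP: y => b y; rewrite sqnorm_cons sqnorm_nil addr0 sqrtr_sqr.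
  rewrite integral_gaussS; side.
  under eq_integral.
    move=> u _; rewrite integral_gauss0; last first.
      by apply: (measurable_fun2 mh); meast.
    rewrite sqnorm_cons inner_cons sqnorm_nil inner_nil addr0 addr0; over.
  rewrite /=; under [RHS]eq_integral.
    move=> u _; rewrite integral_gauss0; last first.
      by apply: (measurable_fun2 mh); meast.
    rewrite sqnorm_nil addr0; over.
  have [b0|b0] := leP 0%R b.
    by rewrite ger0_norm//; apply: eq_integral => u _; rewrite mulrC.
  rewrite ltr0_norm// -stdnormal_opp; side.
  by apply: eq_integral => u _; rewrite sqrrN !mulNr mulrC.
case/tupleP: y => b y; rewrite sqnorm_cons.
rewrite integral_gaussS; side.
under eq_integral.
  move=> w _; under eq_integral do rewrite sqnorm_cons inner_cons.
  rewrite (IHn y (fun q p => h (w ^+ 2 + q)%R (w * b + p)%R)); side.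
  rewrite tonelli; side.
  over.
rewrite tonelli; side.
(* The induction hypothesis has left one Gaussian [u] along the tail of [y]; a rotation in the plane
   of [w] and [u] merges it with the first coordinate [w]. *)
transitivity (\int[gauss n]_z \int[stdnormal]_w \int[stdnormal]_u
    h (w ^+ 2 + u ^+ 2 + sqnorm z)%R (Num.sqrt (b ^+ 2 + sqnorm y) * w)%R).
  apply: eq_integral => z _.
  have := @stdnormal_rotation R (fun q p => h (q + sqnorm z)%R p) b
    (Num.sqrt (sqnorm y)).
  rewrite (sqr_sqrtr (sqnorm_ge0 _)) => <-; side.
  by apply: eq_integral => w _; apply: eq_integral => u _; rewrite mulrC addrA.
rewrite tonelli; side.
apply: eq_integral => w _; rewrite integral_gaussS; side.
rewrite tonelli; side.
by apply: eq_integral => u _; apply: eq_integral => z _; rewrite sqnorm_cons addrA.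
Qed.

End gauss_inner.

(** * The law of the norm *)

Section radial.
Variable R : realType.
Local Notation leb := (@lebesgue_measure R).

Local Open Scope ereal_scope.

Lemma ae_eq_integral_neq0 (f g : R -> \bar R) :
  measurable_fun setT f -> measurable_fun setT g ->
  (forall x, x != 0%R -> f x = g x) -> \int[leb]_x f x = \int[leb]_x g x.
Proof.
move=> mf mg fg; apply: ae_eq_integral => //.
exists [set 0%R]; split => //; first exact: lebesgue_measure_set1.
by move=> x /= H; apply/eqP/negPn/negP => x0; apply: H => _; exact: fg.
Qed.

(** The slope [v = u / a] replaces the angle: [u = a v] gives [|a| ^+ m.+1] and
    [G (a ^+ 2 * (1 + v ^+ 2))], then [r = a sqrt (1 + v ^+ 2)] separates the variables. The
    integral over [v] is a mere constant. *)
Lemma polar_coordinates m (G : R -> \bar R) :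
  measurable_fun setT G -> (forall q, 0 <= G q) ->
  \int[leb]_u \int[leb]_a ((`|a| ^+ m)%:E * G (u ^+ 2 + a ^+ 2)%R) =
  (\int[leb]_v ((Num.sqrt (1 + v ^+ 2))^-1 ^+ m.+2)%:E) *
  \int[leb]_r ((`|r| ^+ m.+1)%:E * G (r ^+ 2)%R).
Proof.
move=> mG G0.
have G0' (a : R) k q : 0 <= (`|a| ^+ k)%:E * G q by rewrite mule_ge0// lee_fin exprn_ge0.
rewrite tonelli//; last first.
  by apply: emeasurable_funM; [meas|apply: (measurableT_comp mG); meas].
transitivity (\int[leb]_a \int[leb]_v
    ((`|a| ^+ m.+1)%:E * G (a ^+ 2 * (1 + v ^+ 2))%R)).
  apply: ae_eq_integral_neq0.
  - apply: measurable_fun_integral => //.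
    by apply: emeasurable_funM; [meas|apply: (measurableT_comp mG); meas].
  - apply: measurable_fun_integral => //.
    by apply: emeasurable_funM; [meas|apply: (measurableT_comp mG); meas].
  move=> a a0.
  have mulKa (x : \bar R) : x = `|a|%:E * (`|a|^-1%:E * x).
    by rewrite muleA -EFinM divff ?normr_eq0// mul1e.
  rewrite [LHS]mulKa.
  rewrite -(@integral_scale R a (fun u => (`|a| ^+ m)%:E * G (u ^+ 2 + a ^+ 2)%R))//; last first.
    by apply: emeasurable_funM; [meas|apply: (measurableT_comp mG); meas].
  rewrite -ge0_integralZl//; last first.
    by apply: emeasurable_funM; [meas|apply: (measurableT_comp mG); meas].
  apply: eq_integral => v _; rewrite muleA -EFinM -exprS; congr (_ * G _).
  by ring.
rewrite tonelli//; last first.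
  by apply: emeasurable_funM; [meas|apply: (measurableT_comp mG); meas].
rewrite -ge0_integralZr//; last 2 first.
- by meas.
- by apply: integral_ge0.
apply: eq_integral => v _; set s := Num.sqrt _.
have s0 : (0 < s)%R by rewrite sqrtr_gt0 ltr_wpDr// sqr_ge0.
have s2 : (s ^+ 2 = 1 + v ^+ 2)%R by rewrite sqr_sqrtr// addr_ge0// sqr_ge0.
have sE : (s^-1)%:E = (`|s|^-1)%:E by rewrite gtr0_norm.
rewrite (exprSr s^-1 m.+1) EFinM -muleA sE.
rewrite -(@integral_scale R s (fun r => (`|r| ^+ m.+1)%:E * G (r ^+ 2)%R))//; last 2 first.
- by rewrite gt_eqF.
- by apply: emeasurable_funM; [meas|apply: (measurableT_comp mG); meas].
rewrite -ge0_integralZl//; last 2 first.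
- by apply: emeasurable_funM; [meas|apply: (measurableT_comp mG); meas].
- by rewrite lee_fin exprn_ge0// invr_ge0 ltW.
apply: eq_integral => a _; rewrite muleA -EFinM normrM (gtr0_norm s0) exprMn mulrA.
rewrite -exprMn mulVf ?gt_eqF// expr1n mul1r; congr (_ * G _).
by rewrite exprMn s2 mulrC.
Qed.

Lemma gauss_radial_const m : exists2 c : R, (0 < c)%R &
  forall F : R -> \bar R, measurable_fun setT F -> (forall q, 0 <= F q) ->
  \int[gauss m.+1]_z F (sqnorm z) =
  c%:E * \int[leb]_a ((radw m a)%:E * F (a ^+ 2)%R).
Proof.
elim: m => [|m [c c0 IH]].
  exists ((Num.sqrt (2 * pi))^-1)%R.
    by rewrite invr_gt0 sqrtr_gt0 mulr_gt0// pi_gt0.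
  move=> F mF F0; rewrite integral_gaussS; side.
  under eq_integral.
    move=> u _; rewrite integral_gauss0; last by meast.
    rewrite sqnorm_cons sqnorm_nil addr0; over.
  rewrite integral_stdnormal; side.
  rewrite -ge0_integralZl; side.
  apply: eq_integral => u _; rewrite muleA -EFinM; congr (_%:E * _).
  by rewrite /W /radw subr0 expr0 mul1r.
pose C := \int[leb]_v ((Num.sqrt (1 + v ^+ 2))^-1 ^+ m.+2)%:E.
pose k := (c / Num.sqrt (2 * pi))%R.
have k0 : (0 < k)%R by rewrite divr_gt0// sqrtr_gt0 mulr_gt0// pi_gt0.
have law F : measurable_fun setT F -> (forall q, 0 <= F q) ->
    \int[gauss m.+2]_z F (sqnorm z) =
    k%:E * (C * \int[leb]_r ((radw m.+1 r)%:E * F (r ^+ 2)%R)).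
  move=> mF F0; rewrite integral_gaussS; side.
  have mFu (u : R) : measurable_fun setT (fun q => F (u ^+ 2 + q)%R) by meast.
  under eq_integral.
    move=> u _; under eq_integral do rewrite sqnorm_cons.
    rewrite (IH (fun q => F (u ^+ 2 + q)%R))//; over.
  have mI : measurable_fun setT (fun u : R => \int[leb]_a
      ((radw m a)%:E * F (u ^+ 2 + a ^+ 2)%R)).
    by apply: measurable_fun_integral; side.
  rewrite integral_stdnormal; side.
  pose G q := (expR (- q / 2))%:E * F q.
  have mG : measurable_fun setT G by rewrite /G; meast.
  have G0 q : 0 <= G q by rewrite /G; pos.
  have := @polar_coordinates m G mG G0; rewrite -/C.
  rewrite (_ : \int[leb]_r ((`|r| ^+ m.+1)%:E * G (r ^+ 2)%R) =
    \int[leb]_r ((radw m.+1 r)%:E * F (r ^+ 2)%R)); last first.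
    by apply: eq_integral => r _; rewrite muleA.
  move=> <-; rewrite -ge0_integralZl; side.
    apply: eq_integral => u _.
    rewrite muleA -EFinM -!ge0_integralZl; side.
    apply: eq_integral => a _; rewrite /G /radw !muleA -!EFinM; congr (_%:E * _).
    rewrite /W subr0 /k (_ : - (u ^+ 2 + a ^+ 2) / 2 = - u ^+ 2 / 2 + - a ^+ 2 / 2)%R.
      by rewrite expRD; ring.
    by field.
have C0 : 0 <= C by apply: integral_ge0 => v _; rewrite lee_fin exprn_ge0// invr_ge0.
set X := fun F : R -> \bar R => \int[leb]_r ((radw m.+1 r)%:E * F (r ^+ 2)%R) in law.
have X0 : 0 <= X (cst 1).
  by apply: integral_ge0 => r _; rewrite mule_ge0// lee_fin radw_ge0.
(* The total mass [1] forces the angular factor [C] to be positive and finite, without evaluating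
   it. *)
have : 1 = k%:E * (C * X (cst 1)).
  by rewrite /X -law ?integral_prob_cst//; meast.
move: C0 X0 law; case: C => [C| |]//; last first.
  move=> _ X0 _; have [->|Xn0] := eqVneq (X (cst 1)) 0.
    by rewrite !mule0 => /eqP; rewrite onee_eq0.
  by rewrite gt0_mulye ?lt_def ?Xn0// gt0_muley ?lte_fin.
rewrite lee_fin => C0 X0 law E.
have {}C0 : (0 < C)%R.
  rewrite lt_def C0 andbT; apply/eqP => C00.
  by move: E; rewrite C00 mul0e mule0 => /eqP; rewrite onee_eq0.
exists (k * C)%R; first exact: mulr_gt0.
by move=> F mF F0; rewrite law// muleA EFinM.
Qed.

(** Equals [2 ^ ((m + 1) / 2) Gamma ((m + 1) / 2)]: the weight is even and both half-lines count. It
    normalises the law of the norm in dimension [m + 1]. *)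
Definition radint m : R := fine (\int[leb]_a (radw m a)%:E).

Lemma radint_gt0_E m : (0 < radint m)%R /\
  \int[leb]_a (radw m a)%:E = (radint m)%:E.
Proof.
have [c c0 /(_ (cst 1))] := gauss_radial_const m.
rewrite integral_prob_cst => H; have {H} := H ltac:(meast) (fun _ => lee01).
under eq_integral do rewrite mule1.
rewrite /radint; set I := \int[leb]_a _.
have : 0 <= I by rewrite /I; pos.
case: I => [x| |]//=.
  rewrite lee_fin => x0 [E]; split => //; rewrite lt_def x0 andbT.
  by apply/eqP => X; move/eqP: E; rewrite X mulr0 oner_eq0.
by rewrite gt0_muley// lte_fin.
Qed.

Lemma radint_gt0 m : (0 < radint m)%R.
Proof. by have [] := radint_gt0_E m. Qed.

Lemma integral_radw m : \int[leb]_a (radw m a)%:E = (radint m)%:E.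
Proof. by have [] := radint_gt0_E m. Qed.

Lemma integral_gauss_radial m (F : R -> \bar R) :
  measurable_fun setT F -> (forall q, 0 <= F q) ->
  \int[gauss m.+1]_z F (sqnorm z) =
  ((radint m)^-1)%:E * \int[leb]_a ((radw m a)%:E * F (a ^+ 2)%R).
Proof.
have [c c0 law] := gauss_radial_const m => mF F0.
rewrite law//; congr (_%:E * _).
have := law (cst 1) ltac:(meast) (fun _ => lee01).
rewrite integral_prob_cst; under eq_integral do rewrite mule1.
rewrite integral_radw => -[E]; have I0 : radint m != 0%R by rewrite gt_eqF ?radint_gt0.
by apply: (mulIf I0); rewrite mulVf.
Qed.

End radial.

(** * Tail and moment estimates *)

Section gaussian_tail.
Variable R : realType.
Local Notation leb := (@lebesgue_measure R).

Lemma integral_gaussian_tail (q s : R) : 0 < q -> 0 < s ->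
  (\int[leb]_(a in `[s, +oo[) (q * a * expR (- (q * a ^+ 2 / 2)))%:E =
   (expR (- (q * s ^+ 2 / 2)))%:E)%E.
Proof.
move=> q0 s0.
pose F (a : R) := - expR (- (q / 2) * a ^+ 2).
pose f (a : R) := q * a * expR (- (q * a ^+ 2 / 2)).
have FE (a : R) : F a = - expR (- (q * a ^+ 2 / 2)).
  by rewrite /F; congr (- expR _); ring.
have dF (x : R) : is_derive x 1 F (f x).
  have H1 : is_derive x 1 (fun a : R => - (q / 2) * a ^+ 2) (- (q * x)).
    apply: is_derive_eq; rewrite -[_ *: _]/(_ * _) -[x%:A]/(x * 1) mulr1.
    by field.
  have H2 := @is_derive1_comp R expR (fun a => - (q / 2) * a ^+ 2) x _ _
    (is_derive_expR _) H1.
  have H3 := is_deriveN H2.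
  have -> : f x = - (expR (- (q / 2) * x ^+ 2) * - (q * x)).
    rewrite /f mulrN opprK mulrC; congr (expR _ * _); ring.
  exact: H3.
have cf : continuous f.
  have -> : f = (fun a => q * a * expR (- (q / 2) * a ^+ 2)).
    by apply/funext => a; rewrite /f; congr (_ * expR _); ring.
  move=> x; apply: cvgM; first by apply: cvgM; [exact: cvg_cst|exact: cvg_id].
  apply: (cvg_comp (fun a => - (q / 2) * a ^+ 2) expR); last exact: continuous_expR.
  by apply: cvgM; [exact: cvg_cst|exact: exprn_continuous].
have := @ge0_continuous_FTC2y R f F s 0.
rewrite FE EFinN sub0e oppeK; apply.
- by move=> x sx; rewrite /f !mulr_ge0 ?expR_ge0 ?(ltW q0)// (le_trans (ltW s0)).
- exact: continuous_subspaceT.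
- rewrite -oppr0; apply: cvgN.
  rewrite (_ : (fun x => _) = (fun x => expR (- (x ^+ 2 * (q / 2))))); last first.
    by apply/funext => a; congr expR; ring.
  apply: (cvg_comp (fun x => x ^+ 2 * (q / 2)) (fun x => expR (- x))); last exact: cvgr_expR.
  by apply: gt0_cvgMly; [rewrite divr_gt0|exact: cvgr_expr2].
- by move=> x _; have := dF x; case.
- apply: cvg_at_right_filter.
  rewrite -FE; suff : {for s, continuous F} by move=> H; exact: H.
  by apply/differentiable_continuous/derivable1_diffP; have := dF s; case.
- by move=> x _; rewrite derive1E; have := dF x; case.
Qed.

(** Mills' bound: on [s <= a] the factor [a / s >= 1] may be inserted, and the integrand becomes an
    exact derivative. *)
Lemma integral_gaussian_tail_le (q s : R) : 0 < q -> 0 < s ->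
  (\int[leb]_a ((s <= a)%R%:R * expR (- (q * a ^+ 2 / 2)))%:E <=
   (expR (- (q * s ^+ 2 / 2)) / (q * s))%:E)%E.
Proof.
move=> q0 s0.
rewrite mulrC EFinM -integral_gaussian_tail//.
rewrite -ge0_integralZl//=; last 3 first.
- by apply: measurable_funTS; meast.
- move=> x; rewrite in_itv/= andbT => sx; rewrite lee_fin.
  by rewrite !mulr_ge0 ?expR_ge0 ?(ltW q0)// (le_trans (ltW s0)).
- by rewrite lee_fin invr_ge0 mulr_ge0// ltW.
rewrite [leRHS]integral_mkcond; apply: ge0_le_integralT.
- by meast.
- by apply/(measurable_restrictT _ _).1 => //; apply: measurable_funTS; meast.
- by move=> x; pos.
move=> x; rewrite patchE mem_setE/= in_itv/= andbT.
case: ifP => sx; last by rewrite mul0r.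
rewrite mul1r -EFinM lee_fin [leRHS]mulrA ler_peMl ?expR_ge0//.
by rewrite mulrC ler_pdivlMr ?mulr_gt0// mul1r ler_pM2l.
Qed.

End gaussian_tail.

Section radial_moments.
Variable R : realType.
Local Notation leb := (@lebesgue_measure R).
Local Open Scope ereal_scope.

Lemma integral_radw_scale m (s : R) : (0 < s)%R ->
  \int[leb]_a (`|a| ^+ m * expR (- (s * a) ^+ 2 / 2))%:E =
  (s^-1 ^+ m.+1 * radint R m)%:E.
Proof.
move=> s0; rewrite exprSr -mulrA EFinM.
have -> : (s^-1 * radint R m)%:E = (`|s|^-1)%:E * (radint R m)%:E.
  by rewrite gtr0_norm// EFinM.
rewrite -integral_radw -(@integral_scale R s (fun a => (radw m a)%:E));
  [|by rewrite gt_eqF|meast|pos].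
rewrite -ge0_integralZl; side.
have sV : (s^-1 ^+ m * s ^+ m = 1)%R by rewrite -exprMn mulVf ?gt_eqF// expr1n.
apply: eq_integral => a _; rewrite -EFinM /radw normrM (gtr0_norm s0).
rewrite [((s * _) ^+ m)%R]exprMn -[(s ^+ m * _ * _)%R]mulrA; congr EFin.
by rewrite [RHS]mulrA sV mul1r.
Qed.

Lemma bernoulli (x : R) k : (-1 <= x)%R -> (1 + k%:R * x <= (1 + x) ^+ k)%R.
Proof.
move=> x1; elim: k => [|k IH]; first by rewrite mul0r addr0 expr0.
rewrite exprS; apply: le_trans (_ : (1 + x) * (1 + k%:R * x) <= _)%R; last first.
  by apply: ler_wpM2l => //; rewrite -lerBlDl sub0r.
have : (0 <= k%:R * x ^+ 2)%R by rewrite mulr_ge0 ?sqr_ge0.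
rewrite -natr1; nra.
Qed.

(** The recursion [I (m + 2) = (m + 1) I m] up to a factor 8. With [k = m + 1], [x <= exp x] bounds
    [a ^+ 2] by [4 k exp (a ^+ 2 / (4 k))], which rescales the Gaussian by [s],
    [s ^+ 2 = 1 - 1 / (2 k)]; Bernoulli keeps [s ^+ k] above 1/2. *)
Lemma radint_SS_le m : (radint R m.+2 <= 8 * m.+1%:R * radint R m)%R.
Proof.
pose k : R := m.+1%:R.
have k1 : (1 <= k)%R by rewrite /k ler1n.
have k0 : (0 < k)%R by exact: lt_le_trans ltr01 k1.
pose s := Num.sqrt (1 - (2 * k)^-1)%R.
have i2k : ((2 * k)^-1 <= 2^-1)%R.
  by rewrite lef_pV2 ?posrE ?mulr_gt0// ler_peMr.
have hh : (0 < 1 - (2 * k)^-1)%R.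
  by rewrite subr_gt0 (le_lt_trans i2k)// invf_lt1 ?ltr1n.
have s0 : (0 < s)%R by rewrite sqrtr_gt0.
have s2 : (s ^+ 2 = 1 - (2 * k)^-1)%R by rewrite sqr_sqrtr// ltW.
have sk : (2^-1 <= s ^+ m.+1)%R.
  have s1 : (s <= 1)%R.
    by rewrite -(@expr_le1 _ 2)// ?(ltW s0)// s2 lerBlDr lerDl invr_ge0 mulr_ge0// ltW.
  apply: le_trans (_ : (s ^+ 2) ^+ m.+1 <= _)%R; last first.
    rewrite -exprM mulnC exprM; set t := (s ^+ m.+1)%R.
    have t0 : (0 <= t)%R by rewrite exprn_ge0// ltW.
    have t1 : (t <= 1)%R by rewrite exprn_ile1// ltW.
    by rewrite expr2 ler_piMl.
  rewrite s2; apply: le_trans (bernoulli m.+1 _); last first.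
    by rewrite lerN2 (le_trans i2k)// invf_le1 ?ler1n.
  by rewrite -/k (_ : k * - (2 * k)^-1 = - 2^-1)%R; [lra|field; rewrite gt_eqF].
have sV : (s^-1 ^+ m.+1 <= 2)%R.
  by rewrite exprVn -[leRHS]invrK lef_pV2 ?posrE ?exprn_gt0.
rewrite -lee_fin -integral_radw.
apply: le_trans (_ : (4 * k * (s^-1 ^+ m.+1 * radint R m))%:E <= _).
  rewrite (EFinM (4 * k)) -integral_radw_scale// -ge0_integralZl; side.
  apply: ge0_le_integralT; [by meast|by meast|by move=> x; pos|].
  move=> a; rewrite -EFinM lee_fin /radw -[in (`|a| ^+ m.+2)%R]addn2 exprD real_normK ?num_real//.
  rewrite -mulrA [leRHS]mulrCA ler_wpM2l ?exprn_ge0//.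
  have -> : (- a ^+ 2 / 2 = - (a ^+ 2 / (4 * k)) + - (s * a) ^+ 2 / 2)%R.
    by rewrite exprMn s2; field; rewrite gt_eqF.
  rewrite expRD expRN mulrA ler_wpM2r ?expR_ge0//.
  rewrite ler_pdivrMr ?expR_gt0// [leRHS]mulrC -ler_pdivrMr ?mulr_gt0//.
  by apply: le_trans (expR_ge1Dx _); rewrite lerDr.
rewrite lee_fin; have I0 := radint_gt0 R m; rewrite [leLHS]mulrA ler_wpM2r ?(ltW I0)//.
rewrite -/k (_ : 8 * k = 4 * k * 2)%R; last by ring.
by rewrite ler_wpM2l ?mulr_ge0// ltW.
Qed.

(** The converse comparison, from [exp (- x) >= 1 - x] at [x = 3 a ^+ 2 / (2 k)]. The 3 yields
    [s ^+ (2 k) >= 1 + 3], so that at most half of [radint R m] reappears on the right and can be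
    absorbed. *)
Lemma radint_le_SS m : (m.+1%:R * radint R m <= 3 * radint R m.+2)%R.
Proof.
pose k : R := m.+1%:R.
have k1 : (1 <= k)%R by rewrite /k ler1n.
have k0 : (0 < k)%R by exact: lt_le_trans ltr01 k1.
pose s := Num.sqrt (1 + 3 / k)%R.
have k30 : (0 < 3 / k)%R by rewrite divr_gt0.
have s0 : (0 < s)%R by rewrite sqrtr_gt0 addr_gt0.
have s2 : (s ^+ 2 = 1 + 3 / k)%R by rewrite sqr_sqrtr// addr_ge0// ltW.
have sk : (2 <= s ^+ m.+1)%R.
  rewrite -(@ler_pXn2r _ 2) ?nnegrE ?exprn_ge0// ?(ltW s0)//.
  rewrite -exprM mulnC exprM s2; apply: le_trans (bernoulli m.+1 _).
    by rewrite -/k (_ : k * (3 / k) = 3)%R; [lra|field; rewrite gt_eqF].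
  by rewrite (le_trans _ (ltW k30)).
have sV : (s^-1 ^+ m.+1 <= 2^-1)%R.
  by rewrite exprVn lef_pV2 ?posrE ?exprn_gt0.
have : (radint R m <= s^-1 ^+ m.+1 * radint R m + 3 / (2 * k) * radint R m.+2)%R.
  rewrite -lee_fin EFinD (EFinM (3 / (2 * k))) -integral_radw_scale// -!integral_radw.
  rewrite -ge0_integralZl; side.
  have c0 : (0 <= 3 / (2 * k))%R by rewrite divr_ge0// mulr_ge0// ltW.
  rewrite -ge0_integralD; side.
  apply: ge0_le_integralT; [by meast|by meast|by move=> x; pos|].
  move=> a; rewrite -EFinM -EFinD lee_fin /radw -[in (`|a| ^+ m.+2)%R]addn2.
  rewrite exprD real_normK ?num_real//.
  rewrite -[(`|a| ^+ m * a ^+ 2 * _)%R]mulrA [X in (_ <= _ + X)%R]mulrCA -mulrDr.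
  rewrite ler_wpM2l ?exprn_ge0//.
  have -> : (- (s * a) ^+ 2 / 2 = - (3 * a ^+ 2 / (2 * k)) + - a ^+ 2 / 2)%R.
    by rewrite exprMn s2; field; rewrite gt_eqF.
  rewrite expRD [X in (_ <= _ + X)%R]mulrA -mulrDl ler_peMl ?expR_ge0//.
  rewrite [X in (_ <= _ + X)%R](_ : _ = 3 * a ^+ 2 / (2 * k))%R; last by ring.
  by rewrite -lerBlDr; exact: expR_ge1Dx.
have I0 := radint_gt0 R m; have J0 := radint_gt0 R m.+2.
set A := (s^-1 ^+ m.+1)%R in sV *; move=> H.
have H2 : (radint R m <= 3 / k * radint R m.+2)%R.
  rewrite (_ : 3 / k * radint R m.+2 = 2 * (3 / (2 * k) * radint R m.+2))%R; last first.
    by field; rewrite gt_eqF.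
  have := ler_wpM2r (ltW I0) sV; move: H.
  by set x := (A * _)%R; set y := (3 / (2 * k) * _)%R; lra.
rewrite -/k (_ : 3 * _ = k * (3 / k * radint R m.+2))%R ?ler_wpM2l ?(ltW k0)//.
by field; rewrite gt_eqF.
Qed.

(** The moment is bounded through its two neighbours by [|a| <= c / 2 + a ^+ 2 / (2 c)], at the
    balanced value [c = sqrt (m + 1)]. *)
Lemma radint_S_le m : (radint R m.+1 <= 5 * Num.sqrt m.+1%:R * radint R m)%R.
Proof.
pose c := Num.sqrt (m.+1%:R : R).
have c0 : (0 < c)%R by rewrite sqrtr_gt0.
have c2 : (c ^+ 2 = m.+1%:R)%R by rewrite sqr_sqrtr.
have : (radint R m.+1 <= c / 2 * radint R m + (2 * c)^-1 * radint R m.+2)%R.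
  rewrite -lee_fin EFinD !EFinM -!integral_radw -!ge0_integralZl; side.
  have c1 : (0 <= c / 2)%R by rewrite divr_ge0// ltW.
  have c3 : (0 <= (2 * c)^-1)%R by rewrite invr_ge0 mulr_ge0// ltW.
  rewrite -ge0_integralD; side.
  apply: ge0_le_integralT; [by meast|by meast|by move=> x; pos|].
  move=> a; rewrite -!EFinM -EFinD lee_fin /radw.
  set E := expR _; rewrite !(exprS `|a|); set t := (`|a| ^+ m)%R; set b := `|a|%R.
  have E0 : (0 <= E)%R by exact: expR_ge0.
  have t0 : (0 <= t)%R by rewrite exprn_ge0.
  rewrite -subr_ge0 [X in (0 <= X)%R](_ : _ = t * E * (b - c) ^+ 2 / (2 * c))%R.
    pos.
  by field; rewrite gt_eqF.
move=> H; apply: le_trans H _; have H := radint_SS_le m.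
apply: le_trans (_ : c / 2 * radint R m + (2 * c)^-1 * (8 * m.+1%:R * radint R m) <= _)%R.
  by rewrite lerD2l ler_wpM2l// invr_ge0 mulr_ge0// ltW.
rewrite -/c -[in (8 * m.+1%:R)%R]c2 -subr_ge0.
have I0 := radint_gt0 R m.
rewrite [X in (0 <= X)%R](_ : _ = c * radint R m / 2)%R; first pos.
by field; rewrite gt_eqF.
Qed.

(** Both factors [n^(-1/2)] in the cost of a competitor come out of this one ratio. The constant is
    [3 * 3 * 25] times the bound 4/3 on [(k + 3) / (k + 2)], where [k = p + 1]. *)
Lemma radint_ratio p :
  (radint R p.+4 * radint R p <= 300 / p.+1%:R * radint R p.+3 ^+ 2)%R.
Proof.
have I0 := radint_gt0 R p; have I2 := radint_gt0 R p.+2.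
have I3 := radint_gt0 R p.+3; have I4 := radint_gt0 R p.+4.
have := radint_le_SS p; have := radint_le_SS p.+2; have := radint_S_le p.+3.
set c := Num.sqrt _; set k : R := p.+1%:R.
have c2 : (c ^+ 2 = k + 3)%R by rewrite sqr_sqrtr// /k -[p.+4]addn4 -addn1 !natrD; ring.
have -> : (p.+3%:R = k + 2)%R by rewrite /k -[p.+3]addn3 -addn1 !natrD; ring.
have k1 : (1 <= k)%R by rewrite /k ler1n.
have c0 : (0 <= c)%R by rewrite sqrtr_ge0.
move: I0 I2 I3 I4.
set i0 := radint _ _; set i2 := radint _ p.+2; set i3 := radint _ _; set i4 := radint _ _.
move=> I0 I2 I3 I4 H1 H2 H3.
have k0 : (0 < k)%R by lra.
rewrite mulrAC ler_pdivlMr//.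
have J : (i4 ^+ 2 <= 25 * (k + 3) * i3 ^+ 2)%R.
  rewrite -c2 (_ : 25 * _ * _ = (5 * c * i3) ^+ 2)%R; last by ring.
  by rewrite !expr2 ler_pM// ltW.
have A : (i4 * i0 * k <= 3 * i4 * i2)%R by nra.
have B : ((k + 2) * (3 * i4 * i2) <= 9 * i4 ^+ 2)%R by nra.
have k2 : (0 < k + 2)%R by lra.
rewrite -(ler_pM2l k2); apply: le_trans (_ : 9 * i4 ^+ 2 <= _)%R.
  by apply: le_trans B; rewrite ler_wpM2l// ltW.
apply: le_trans (_ : 9 * (25 * (k + 3) * i3 ^+ 2) <= _)%R; first by rewrite ler_wpM2l.
have : (0 <= i3 ^+ 2)%R by rewrite sqr_ge0.
nra.
Qed.

End radial_moments.

(** * Spherical caps *)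

Section cap.
Variable R : realType.
Local Notation leb := (@lebesgue_measure R).
Local Notation I m := (radint R m).

(* Since [0^-1 = 0], the direction of the null vector is the null vector. *)
Definition dirt n (g : n.-tuple R) : n.-tuple R := scalet (Num.sqrt (sqnorm g))^-1 g.

Lemma sqnorm_dirt n (g : n.-tuple R) : sqnorm g != 0 -> sqnorm (dirt g) = 1.
Proof.
by move=> g0; rewrite sqnorm_scalet exprVn sqr_sqrtr ?sqnorm_ge0// mulVf.
Qed.

Lemma sqnorm_dirt_le1 n (g : n.-tuple R) : sqnorm (dirt g) <= 1.
Proof.
have [g0|/sqnorm_dirt->//] := eqVneq (sqnorm g) 0.
by rewrite sqnorm_scalet g0 mulr0.
Qed.

Lemma inner_dirt n (g y : n.-tuple R) :
  inner (dirt g) y = (Num.sqrt (sqnorm g))^-1 * inner g y.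
Proof. by rewrite inner_scaletl. Qed.

Lemma measurable_fun_dirt d (T : measurableType d) n (f : T -> n.-tuple R) :
  measurable_fun setT f -> measurable_fun setT (fun x => dirt (f x)).
Proof. by move=> mf; rewrite /dirt; meast. Qed.

Local Open Scope ereal_scope.

Lemma integral_gauss_polar m (y : m.+2.-tuple R) (h : R -> R -> \bar R) :
  measurable_fun setT (fun p : R * R => h p.1 p.2) ->
  (forall q p, 0 <= h q p) ->
  \int[gauss m.+2]_z h (sqnorm z) (inner z y) =
  ((I m)^-1)%:E * \int[stdnormal]_u \int[leb]_a
    ((radw m a)%:E * h (u ^+ 2 + a ^+ 2)%R (Num.sqrt (sqnorm y) * u)%R).
Proof.
move=> mh h0; have I0 := radint_gt0 R m.
rewrite integral_gauss_inner; side.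
rewrite -ge0_integralZl; side.
apply: eq_integral => u _.
rewrite (@integral_gauss_radial _ _
  (fun q => h (u ^+ 2 + q)%R (Num.sqrt (sqnorm y) * u)%R)); side.
by [].
Qed.

Lemma stdnormal_tail_le (t : R) : (0 < t)%R ->
  \int[stdnormal]_u ((t <= u)%R%:R)%:E <=
  (expR (- (t ^+ 2 / 2)) / (Num.sqrt (2 * pi) * t))%:E.
Proof.
move=> t0; rewrite integral_stdnormal; side.
have w0 : (0 <= (Num.sqrt (2 * pi : R))^-1)%R by pos.
have := integral_gaussian_tail_le (ltr01 : (0 < 1 :> R)%R) t0.
rewrite !mul1r => /(lee_wpmul2l (w0 : 0 <= (_)%:E)).
rewrite -ge0_integralZl; side.
rewrite -EFinM mulrCA -invfM => /(le_trans _); apply.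
apply: ge0_le_integralT; side.
move=> u; rewrite -!EFinM lee_fin /W subr0 mul1r -mulrA [X in (_ <= _ * X)%R]mulrC.
by rewrite mulNr.
Qed.

(** Equals [(1 + t^2)^(-(m + 1)/2) radint R m]. It stays an integral because [second_term_le]
    integrates over the slope before integrating over [a]. *)
Definition capint m (t : R) : \bar R :=
  \int[leb]_a (radw m a * expR (- (t ^+ 2 * a ^+ 2 / 2)))%:E.

(** Split [g] into its component [u] along [y] and an orthogonal part of norm [|a|]: squaring the
    inequality gives [(s / b) |a| <= u]. The Gaussian tail bound brings a factor [1 / |a|], which
    lowers the radial weight from [m + 1] to [m]. *)
Lemma cap_le m (y : m.+3.-tuple R) (s b : R) : (0 < s)%R -> (0 < b)%R ->
  sqnorm y = (s ^+ 2 + b ^+ 2)%R ->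
  \int[gauss m.+3]_g ((s <= inner (dirt g) y)%R%:R)%:E <=
  ((Num.sqrt (2 * pi) * I m.+1 * (s / b))^-1)%:E * capint m (s / b).
Proof.
move=> s0 b0 yE; have I0 := radint_gt0 R m.+1.
pose t := (s / b)%R; have t0 : (0 < t)%R by rewrite divr_gt0.
have pi0 : (0 < Num.sqrt (2 * pi : R))%R by rewrite sqrtr_gt0 mulr_gt0// pi_gt0.
pose h (q p : R) : \bar R := ((s <= (Num.sqrt q)^-1 * p)%R%:R)%:E.
under eq_integral do rewrite inner_dirt -/(h _ _).
rewrite integral_gauss_polar; [|by rewrite /h; meast|by move=> q p; rewrite /h; pos].
rewrite -/t mulrAC invfM mulrC EFinM -muleA; apply: lee_wpmul2l; first by pos.
rewrite tonelli; [|by rewrite /h; meast|by move=> *; rewrite /h; pos].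
rewrite /capint -ge0_integralZl; side.
apply: ge0_le_integralT; [by rewrite /h; meast|by meast|by move=> *; rewrite /h; pos|].
move=> a; rewrite ge0_integralZl; [|by []|by rewrite /h; meast|by move=> *; rewrite /h; pos|by pos].
have [->|a0] := eqVneq a 0%R.
  rewrite [X in X%:E * _ <= _]/radw normr0 expr0n mul0r mul0e.
  by rewrite -EFinM; pos.
have na0 : (0 < `|a|)%R by rewrite normr_gt0.
apply: le_trans (_ : (radw m.+1 a)%:E * (expR (- ((t * `|a|) ^+ 2 / 2)) /
    (Num.sqrt (2 * pi) * (t * `|a|)))%:E <= _).
  apply: lee_wpmul2l; first by pos.
  apply: le_trans (stdnormal_tail_le _); last by rewrite mulr_gt0.
  apply: ge0_le_integralT; [by rewrite /h; meast|by meast|by move=> *; rewrite /h; pos|].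
  move=> u; rewrite /h lee_fin ler_nat; case: leP => //= su; rewrite lt0b.
  have q0 : (0 < u ^+ 2 + a ^+ 2)%R by rewrite ltr_wpDl ?sqr_ge0// exprn_even_gt0.
  have r0 : (0 < Num.sqrt (u ^+ 2 + a ^+ 2))%R by rewrite sqrtr_gt0.
  move: su; rewrite mulrC ler_pdivlMr// yE => su.
  have u0 : (0 < u)%R.
    have : (0 < Num.sqrt (s ^+ 2 + b ^+ 2) * u)%R.
      by apply: lt_le_trans su; rewrite mulr_gt0.
    by rewrite pmulr_rgt0// sqrtr_gt0 addr_gt0// exprn_gt0.
  have : ((s * Num.sqrt (u ^+ 2 + a ^+ 2)) ^+ 2 <= (Num.sqrt (s ^+ 2 + b ^+ 2) * u) ^+ 2)%R.
    by rewrite !expr2 ler_pM// mulr_ge0// ltW.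
  rewrite !exprMn !sqr_sqrtr; [|by rewrite addr_ge0// sqr_ge0|by rewrite ltW].
  move=> H; rewrite /t mulrAC ler_pdivrMr//.
  rewrite -(@ler_pXn2r _ 2)// ?nnegrE ?mulr_ge0 ?(ltW s0) ?(ltW u0) ?(ltW b0)//.
  rewrite !exprMn real_normK ?num_real//; lra.
rewrite -!EFinM lee_fin /radw exprMn real_normK ?num_real// exprS.
rewrite le_eqVlt; apply/orP; left; apply/eqP.
by field; rewrite !gt_eqF.
Qed.

End cap.

Lemma tonelli3 d1 d2 d3 (T1 : measurableType d1) (T2 : measurableType d2)
    (T3 : measurableType d3) (R : realType)
    (m1 : {sigma_finite_measure set T1 -> \bar R})
    (m2 : {sigma_finite_measure set T2 -> \bar R})
    (m3 : {sigma_finite_measure set T3 -> \bar R}) (f : T1 -> T2 -> T3 -> \bar R) :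
  measurable_fun setT (fun p : (T1 * T2) * T3 => f p.1.1 p.1.2 p.2) ->
  (forall x y z, 0 <= f x y z)%E ->
  (\int[m1]_x \int[m2]_y \int[m3]_z f x y z =
   \int[m2]_y \int[m3]_z \int[m1]_x f x y z)%E.
Proof.
move=> mf f0.
have mf' : measurable_fun setT (fun p : T1 * T2 => \int[m3]_z f p.1 p.2 z)%E.
  exact: (@measurable_fun_integral _ _ _ _ _ m3 (fun p z => f p.1 p.2 z)).
rewrite (tonelli _ _ mf'); last by move=> x y; apply: integral_ge0.
apply: eq_integral => y _; apply: (@tonelli _ _ _ _ _ m1 m3 (fun x z => f x y z)) => //.
apply: (@measurableT_comp _ _ _ _ _ _ (fun p : (T1 * T2) * T3 => f p.1.1 p.1.2 p.2)
  _ (fun p : T1 * T3 => ((p.1, y), p.2))) => //.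
by meas.
Qed.

(** * The mean cost of one competitor *)

Section second_term.
Variable R : realType.
Local Notation leb := (@lebesgue_measure R).
Local Notation I m := (radint R m).
Local Notation w := (Num.sqrt (2 * pi : R)).
Local Open Scope ereal_scope.

Lemma measurable_fun_capint d (T : measurableType d) m (f : T -> R) :
  measurable_fun setT f -> measurable_fun setT (fun x => capint m (f x)).
Proof. by move=> mf; rewrite /capint; meast. Qed.

Lemma capint_ge0 m (t : R) : 0 <= capint m t.
Proof. by rewrite /capint; pos. Qed.

(* The contribution of one competing codeword, as a function of the component
   [s] of the channel output along the codeword and of the norm [b] of the
   orthogonal part. *)
Definition confusion p (tau s b : R) : \bar R :=
  ((tau * `|b| < s) && (b != 0))%R%:R%:E *
  (((w * I p.+3 * (s / `|b|))^-1)%:E * capint p.+2 (s / `|b|)).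

Lemma measurable_fun_confusion d (T : measurableType d) p tau (f g : T -> R) :
  measurable_fun setT f -> measurable_fun setT g ->
  measurable_fun setT (fun x => confusion p tau (f x) (g x)).
Proof.
move=> mf mg; rewrite /confusion.
apply: emeasurable_funM; first by meast.
by apply: emeasurable_funM; [meast|apply: measurable_fun_capint; meast].
Qed.

Lemma confusion_ge0 p tau s b : (0 < tau)%R -> 0 <= confusion p tau s b.
Proof.
move=> t0; rewrite /confusion; case: (boolP (_ && _)) => [/andP[ts b0]|_]; last by rewrite mul0e.
have s0 : (0 < s)%R by apply: le_lt_trans ts; rewrite mulr_ge0// ltW.
have I0 := radint_gt0 R p.+3.
rewrite mule_ge0// mule_ge0 ?capint_ge0// lee_fin invr_ge0.
by rewrite mulr_ge0 ?divr_ge0 ?(ltW s0)// mulr_ge0 ?(ltW I0).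
Qed.

(** Integrating over [s] first is what decouples the variables: the tail beyond [tau |b|] has the
    exponent [- tau ^+ 2 a ^+ 2 / 2], free of [b]. The integrals over [a] and [b] then give
    [radint R p] and [radint R p.+4], to which [radint_ratio] applies. *)
Lemma second_term_le p (c tau : R) : (0 < tau)%R ->
  \int[stdnormal]_u \int[leb]_b ((radw p.+3 b)%:E * confusion p tau (c + u) b) <=
  (I p.+3 * (300 / (p.+1%:R * tau ^+ 2) * (Num.sqrt (1 + tau ^+ 2))^-1 ^+ p.+1))%:E.
Proof.
move=> t0; have I0 := radint_gt0 R p.+3.
have w0 : (0 < w)%R by rewrite sqrtr_gt0 mulr_gt0// pi_gt0.
pose J s b := (radw p.+3 b)%:E * confusion p tau s b.
have mJ : measurable_fun setT (fun x : R * R => J x.1 x.2).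
  by apply: emeasurable_funM; [meast|apply: measurable_fun_confusion; meast].
have J0 s b : 0 <= J s b.
  by rewrite mule_ge0 ?confusion_ge0// lee_fin radw_ge0.
pose g s := \int[leb]_b J s b.
have mg : measurable_fun setT g by apply: measurable_fun_integral; [exact: mJ|exact: J0].
have g0 s : 0 <= g s by apply: integral_ge0 => b _; exact: J0.
have mgc : measurable_fun setT (fun u => g (c + u)%R).
  by apply: (measurableT_comp mg); meast.
rewrite (_ : \int[stdnormal]_u _ = \int[stdnormal]_u g (c + u)%R)//.
rewrite integral_stdnormal; [|exact: mgc|by move=> u; exact: g0].
(* The normal density is replaced by its maximum [w^-1]; translation invariance then removes [c]. *)
apply: le_trans (_ : \int[leb]_u ((w^-1)%:E * g (c + u)%R) <= _).
  apply: ge0_le_integralT; [|by apply: emeasurable_funM; [meast|exact: mgc]| |].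
  - by apply: emeasurable_funM; [meast|exact: mgc].
  - by move=> u; rewrite mule_ge0// lee_fin W_ge0.
  move=> u; apply: lee_wpmul2r => //; rewrite lee_fin /W ler_piMr ?invr_ge0 ?(ltW w0)//.
  by rewrite expR_le1 mulNr oppr_le0 divr_ge0// sqr_ge0.
rewrite ge0_integralZl; [|by []|exact: mgc|by move=> *; exact: g0|by pos].
under eq_integral do rewrite addrC.
rewrite integral_shift; [|exact: mg|exact: g0].
(* On [tau |b| < s] the slope in the prefactor is at least [tau], so the prefactor no longer depends
   on [s]. *)
pose H (s b a : R) : \bar R := ((w * I p.+3 * tau)^-1)%:E * ((radw p.+3 b)%:E *
  ((radw p.+2 a)%:E * ((tau * `|b| <= s)%R%:R *
     expR (- ((a / `|b|) ^+ 2 * s ^+ 2 / 2)))%:E)).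
have mH : measurable_fun setT (fun x : (measurableTypeR R * measurableTypeR R) *
    measurableTypeR R => H x.1.1 x.1.2 x.2).
  by rewrite /H; meast.
have H0 s b a : 0 <= H s b a by rewrite /H; pos.
apply: le_trans (_ : (w^-1)%:E * \int[leb]_s \int[leb]_b \int[leb]_a H s b a <= _).
  apply: lee_wpmul2l; first by pos.
  apply: ge0_le_integralT; [exact: mg|by rewrite /H; meast|exact: g0|move=> s].
  apply: ge0_le_integralT; [|by rewrite /H; meast|by move=> b; exact: J0|move=> b].
    by apply: (measurable_fun2 mJ); meast.
  rewrite /J /confusion; case: (boolP (_ && _)) => [/andP[ts b0]|_]; last first.
    by rewrite mul0e mule0; apply: integral_ge0 => a _; exact: H0.
  have nb0 : (0 < `|b|)%R by rewrite normr_gt0.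
  have s0 : (0 < s)%R by apply: le_lt_trans ts; rewrite mulr_ge0// ltW.
  rewrite mul1e muleCA /H ge0_integralZl; [|by []|by meast|by move=> *; pos|by pos].
  rewrite ge0_integralZl; [|by []|by meast|by move=> *; pos|by pos].
  apply: lee_pmul.
  - by pos.
  - by rewrite mule_ge0 ?capint_ge0// lee_fin radw_ge0.
  - have wI0 : (0 < w * I p.+3)%R by rewrite mulr_gt0.
    have sb0 : (0 < s / `|b|)%R by rewrite divr_gt0.
    rewrite lee_fin lef_pV2; [|by rewrite posrE mulr_gt0|by rewrite posrE mulr_gt0].
    by rewrite (ler_pM2l wI0) ler_pdivlMr// ltW.
  apply: lee_wpmul2l; first by rewrite lee_fin radw_ge0.
  rewrite /capint; apply: ge0_le_integralT; [by meast|by meast|by move=> *; pos|].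
  move=> a; rewrite -EFinM lee_fin (ltW ts) mul1r ler_wpM2l ?radw_ge0//.
  by rewrite ler_expR lerN2 le_eqVlt; apply/orP; left; apply/eqP; field; rewrite gt_eqF.
have -> : \int[leb]_s \int[leb]_b \int[leb]_a H s b a =
    \int[leb]_b \int[leb]_a \int[leb]_s H s b a.
  exact: (@tonelli3 _ _ _ _ _ _ R leb leb leb H mH H0).
pose sg := Num.sqrt (1 + tau ^+ 2).
have sg0 : (0 < sg)%R by rewrite sqrtr_gt0 ltr_wpDr ?sqr_ge0.
have sg2 : (sg ^+ 2 = 1 + tau ^+ 2)%R by rewrite sqr_sqrtr// addr_ge0 ?sqr_ge0.
apply: le_trans (_ : (w^-1)%:E * \int[leb]_b \int[leb]_a
    (((w * I p.+3 * tau ^+ 2)^-1)%:E * ((radw p.+4 b)%:E *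
      (`|a| ^+ p * expR (- (sg * a) ^+ 2 / 2))%:E)) <= _).
  apply: lee_wpmul2l; first by pos.
  have mH3 : measurable_fun setT (fun x : R * R => \int[leb]_s H s x.1 x.2).
    by rewrite /H; meast.
  apply: ge0_le_integralT; [|by meast|by move=> *; rewrite /H; pos|move=> b].
    by rewrite /H; meast.
  apply: ge0_le_integralT; [|by meast|by move=> *; rewrite /H; pos|move=> a].
    by rewrite /H; meast.
  rewrite /H ge0_integralZl; [|by []|by meast|by move=> *; pos|by pos].
  rewrite ge0_integralZl; [|by []|by meast|by move=> *; pos|by pos].
  rewrite ge0_integralZl; [|by []|by meast|by move=> *; pos|by pos].
  (* The tail bound breaks down at [a = 0] and at [b = 0], but there a radial weight vanishes. *)
  have [->|a0] := eqVneq a 0%R.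
    rewrite [X in X%:E * \int[_]_x _](_ : _ = 0)%R; last by rewrite /radw normr0 expr0n mul0r.
    by rewrite mul0e !mule0; pos.
  have [->|b0] := eqVneq b 0%R.
    rewrite [X in X%:E * (_ * \int[_]_x _)](_ : _ = 0)%R; last by rewrite /radw normr0 expr0n mul0r.
    by rewrite mul0e !mule0; pos.
  have na0 : (0 < `|a|)%R by rewrite normr_gt0.
  have nb0 : (0 < `|b|)%R by rewrite normr_gt0.
  have q0 : (0 < (a / `|b|) ^+ 2)%R.
    by rewrite exprn_even_gt0//= mulf_neq0// invr_neq0// gt_eqF.
  have := integral_gaussian_tail_le q0 (mulr_gt0 t0 nb0).
  move=> H1; apply: le_trans (_ : ((w * I p.+3 * tau)^-1)%:E * ((radw p.+3 b)%:E *
    ((radw p.+2 a)%:E * (expR (- ((a / `|b|) ^+ 2 * (tau * `|b|) ^+ 2 / 2)) /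
      ((a / `|b|) ^+ 2 * (tau * `|b|)))%:E)) <= _).
    by do 3 (apply: lee_wpmul2l; first by pos).
  have aE : (a ^+ 2 = `|a| ^+ 2)%R by rewrite real_normK ?num_real.
  have bE : (b ^+ 2 = `|b| ^+ 2)%R by rewrite real_normK ?num_real.
  rewrite -!EFinM lee_fin /radw le_eqVlt; apply/orP; left; apply/eqP.
  have -> : (- ((a / `|b|) ^+ 2 * (tau * `|b|) ^+ 2 / 2) = - tau ^+ 2 * a ^+ 2 / 2)%R.
    by field; rewrite gt_eqF.
  have -> : (- (sg * a) ^+ 2 / 2 = - a ^+ 2 / 2 + - tau ^+ 2 * a ^+ 2 / 2)%R.
    by rewrite exprMn sg2; field.
  have b4 : (`|b| ^+ p.+4 = `|b| * `|b| ^+ p.+3)%R by rewrite exprS.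
  have a2 : (`|a| ^+ p.+2 = `|a| ^+ 2 * `|a| ^+ p)%R by rewrite -exprD add2n.
  rewrite expRD [((a / `|b|) ^+ 2)%R]exprMn exprVn aE b4 a2.
  by field; rewrite !gt_eqF.
have Ip := radint_gt0 R p.
rewrite (_ : \int[leb]_b _ = ((w * I p.+3 * tau ^+ 2)^-1 *
    (sg^-1 ^+ p.+1 * I p) * I p.+4)%:E); last first.
  rewrite EFinM -integral_radw -ge0_integralZl; [|by []|by meast|by move=> *; pos|]; last first.
    by pos.
  apply: eq_integral => b _.
  rewrite ge0_integralZl; [|by []|by meast|by move=> *; pos|by pos].
  rewrite ge0_integralZl; [|by []|by meast|by move=> *; pos|by pos].
  rewrite integral_radw_scale// -!EFinM; congr EFin.
  by ring.
rewrite -!EFinM lee_fin -/sg.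
set S := (sg^-1 ^+ p.+1)%R.
have S0 : (0 <= S)%R by rewrite exprn_ge0// invr_ge0 ltW.
have w2 : (w ^+ 2 = 2 * pi)%R by rewrite sqr_sqrtr// mulr_ge0// pi_ge0.
move: w0 w2; set v := w => w0 w2.
have := radint_ratio R p.
set X := (300 / _ * _)%R => HX.
rewrite [leLHS](_ : _ = (I p.+4 * I p) * (S / (2 * pi * I p.+3 * tau ^+ 2)))%R; last first.
  by rewrite -w2; field; rewrite !gt_eqF.
have pi1 : (1 <= 2 * pi :> R)%R.
  by have := pi_ge2 R; lra.
have pi0 : (0 < pi :> R)%R := pi_gt0 R.
apply: le_trans (_ : X * (S / (I p.+3 * tau ^+ 2)) <= _)%R.
  apply: ler_pM => //.
  - by have := radint_gt0 R p.+4; pos.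
  - by pos.
  apply: ler_wpM2l => //; rewrite lef_pV2 ?posrE ?mulr_gt0 ?exprn_gt0//.
  by rewrite -mulrA ler_peMl// mulr_ge0 ?sqr_ge0 ?(ltW I0).
by rewrite /X le_eqVlt; apply/orP; left; apply/eqP; field; rewrite !gt_eqF.
Qed.

End second_term.

(** * The channel and the choice of a codebook *)

Section channel.
Variable R : realType.
Local Notation leb := (@lebesgue_measure R).
Local Open Scope ereal_scope.

Lemma addt_cons n u v (x z : n.-tuple R) :
  addt [tuple of u :: x] [tuple of v :: z] = [tuple of (u + v)%R :: addt x z].
Proof.
apply: eq_from_tnth => i; rewrite tnth_mktuple.
by case: (unliftP ord0 i) => [j|] ->; rewrite ?tnth0// !tnthS tnth_mktuple.
Qed.

Lemma measurable_fun_indic d (T : measurableType d) n (D : set (n.-tuple R))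
    (f : T -> n.-tuple R) : measurable D -> measurable_fun setT f ->
  measurable_fun setT (fun x => ((\1_D (f x)) : R)%:E).
Proof.
move=> mD mf; apply: measurable_fun_EFin.
by apply: (@measurableT_comp _ _ _ _ _ _ (\1_D : n.-tuple R -> R)) => //.
Qed.

(** Coordinate by coordinate, translation invariance moves the codeword from the density into the
    argument of the indicator. *)
Lemma Wn_gauss n (x : n.-tuple R) (D : set (n.-tuple R)) : measurable D ->
  Wn x D = \int[gauss n]_z ((\1_D (addt x z)) : R)%:E.
Proof.
elim: n x D => [|n IH] x D mD.
  rewrite integral_gauss0; last by apply: measurable_fun_indic => //; meast.
  by rewrite /Wn (tuple0 (addt _ _)); congr (\1_D _)%:E; apply/val_inj.
case/tupleP: x => x0 x.
have mcons : measurable_fun setT (fun p : R * n.-tuple R => [tuple of p.1 :: p.2]).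
  by meast.
have mS y : measurable [set z | D (cons_tuple y z)].
  have mc : measurable_fun setT (fun z : n.-tuple R => [tuple of y :: z]) by meast.
  by have := mc measurableT _ mD; rewrite setTI.
pose F (y : R) := \int[gauss n]_z ((\1_D [tuple of y :: addt x z]) : R)%:E.
have mF : measurable_fun setT F.
  apply: measurable_fun_integral; first by apply: measurable_fun_indic => //; meast.
  by move=> y z; rewrite lee_fin.
have F0 y : 0 <= F y by apply: integral_ge0 => z _; rewrite lee_fin.
transitivity (\int[leb]_y ((W y x0)%:E * F y)).
  rewrite /=; apply: eq_integral => y _; rewrite theadE.
  have bE : behead_tuple [tuple of x0 :: x] = x by apply/val_inj.
  rewrite bE.
  by congr (_ * _); rewrite IH.
have mG : measurable_fun setT (fun y => (W y x0)%:E * F y) by meast.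
rewrite -(integral_shift x0 mG); last by move=> y; rewrite mule_ge0 ?lee_fin ?W_ge0.
rewrite integral_gaussS; last 2 first.
- by apply: measurable_fun_indic => //; meast.
- by move=> z; rewrite lee_fin.
rewrite integral_stdnormal; last 2 first.
- apply: measurable_fun_integral; first by apply: measurable_fun_indic => //; meast.
  by move=> y z; rewrite lee_fin.
- by move=> u; apply: integral_ge0 => z _; rewrite lee_fin.
apply: eq_integral => u _; rewrite WE addrK; congr (_ * _).
by apply: eq_integral => z _; rewrite addt_cons addrC.
Qed.

End channel.

Section selection.
Context d (T : measurableType d) (R : realType) (Q : probability T R).
Local Open Scope ereal_scope.

Lemma exists_le_mean (f : T -> \bar R) (c : R) :
  measurable_fun setT f -> (forall x, 0 <= f x) ->
  \int[Q]_x f x < c%:E -> exists x, f x <= c%:E.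
Proof.
move=> mf f0 fc; apply: contrapT => /forallNP H.
have : c%:E <= \int[Q]_x f x.
  rewrite -[leLHS](integral_prob_cst Q).
  have [c0|c0] := leP 0%R c; last first.
    rewrite integral_prob_cst; apply: le_trans (integral_ge0 _ _) => //.
    by rewrite lee_fin ltW.
  apply: ge0_le_integralT; [exact: measurable_cst|exact: mf|by []|].
  by move=> x; rewrite ltW// ltNge; apply/negP/H.
by rewrite leNgt fc.
Qed.

(* Existence of a codebook doing as well as the random one, one codeword at a
   time by conditional expectations, so that no product measure on codebooks is
   needed; the strict inequality absorbs the loss in [exists_le_mean]. *)
Lemma exists_codebook (f2 : T -> T -> \bar R) (beta : R) :
  measurable_fun setT (fun p : T * T => f2 p.1 p.2) ->
  (forall x y, 0 <= f2 x y) -> (forall x y, f2 x y <= 1) ->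
  \int[Q]_x \int[Q]_y f2 x y <= beta%:E ->
  forall M (f1 : T -> \bar R) (alpha : R),
  measurable_fun setT f1 -> (forall x, 0 <= f1 x) ->
  \int[Q]_x f1 x < alpha%:E ->
  exists g : 'I_M -> T,
    \sum_(i < M) (f1 (g i) + \sum_(j < M | j != i) f2 (g i) (g j)) <=
    (M%:R * alpha + M%:R * (M%:R - 1) * beta)%:E.
Proof.
move=> mf2 f20 f21 hbeta; elim=> [|M IH] f1 alpha mf1 f10 halpha.
  have g : 'I_0 -> T by case.
  by exists g; rewrite big_ord0 !mul0r addr0.
have mf2' : measurable_fun setT (fun p : T * T => f2 p.2 p.1) by meast.
have mf2x t : measurable_fun setT (fun x => f2 x t) by meast.
have mf2t t : measurable_fun setT (f2 t) by meast.
pose A t := \int[Q]_x (f2 x t + f2 t x).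
have mA : measurable_fun setT A.
  apply: measurable_fun_integral; first by apply: emeasurable_funD; meast.
  by move=> *; exact: adde_ge0.
have A0 t : 0 <= A t by apply: integral_ge0 => x _; exact: adde_ge0.
have Afin t : A t \is a fin_num.
  rewrite ge0_fin_numE//; apply: le_lt_trans (_ : (2%:R)%:E < +oo); last exact: ltry.
  rewrite -[leRHS](integral_prob_cst Q); apply: ge0_le_integralT.
  - by apply: emeasurable_funD.
  - exact: measurable_cst.
  - by move=> x; exact: adde_ge0.
  - by move=> x; rewrite -[2%:R]/(1 + 1)%R EFinD; exact: leeD.
have IA : \int[Q]_t A t <= (2 * beta)%:E.
  rewrite /A; under eq_integral => t _.
    rewrite ge0_integralD; [|by []|by []|exact: mf2x|by []|exact: mf2t].
    over.
  rewrite ge0_integralD; [|by []|by move=> *; exact: integral_ge0| |by move=> *; exact: integral_ge0|].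
  - rewrite mulr_natl mulr2n EFinD; apply: leeD; last exact: hbeta.
    by rewrite (@tonelli _ _ _ _ _ Q Q (fun t x => f2 x t)).
  - by apply: measurable_fun_integral.
  - by apply: measurable_fun_integral.
(* The expected share of the word [t] in the total cost while the other [M] words are random. Its
   mean is below [alpha + 2 M beta], and [2 M + M (M - 1) = (M + 1) M] makes the count close. *)
pose phi t := f1 t + M%:R%:E * A t.
have mphi : measurable_fun setT phi.
  by apply: emeasurable_funD => //; apply: emeasurable_funM => //; exact: measurable_cst.
have phi0 t : 0 <= phi t by rewrite adde_ge0// mule_ge0.
have [t ht] : exists t, phi t <= (alpha + M%:R * (2 * beta))%:E.
  apply: exists_le_mean => //; rewrite ge0_integralD//; last 2 first.
  - by move=> x _; rewrite mule_ge0.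
  - by apply: emeasurable_funM => //; exact: measurable_cst.
  rewrite ge0_integralZl// EFinD; apply: lte_leD; [|exact: halpha|].
    by rewrite ge0_fin_numE ?mule_ge0 ?integral_ge0//; apply: le_lt_trans (_ : (M%:R * (2 * beta))%:E < +oo);
      rewrite ?ltry// EFinM lee_wpmul2l.
  by rewrite EFinM lee_wpmul2l.
(* Confusions with the fixed word [t] are charged to the individual costs of the remaining words,
   which is why [f1] and [alpha] vary in the induction. *)
pose f1' x := f1 x + (f2 x t + f2 t x).
have [|||g hg] := IH f1' (alpha + fine (A t))%R.
- by apply: emeasurable_funD => //; exact: emeasurable_funD.
- by move=> x; rewrite adde_ge0// adde_ge0.
- rewrite ge0_integralD//; last 2 first.
  + by move=> x _; exact: adde_ge0.
  + by apply: emeasurable_funD.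
  by rewrite EFinD fineK//; apply: lte_leD; [exact: Afin|exact: halpha|].
pose G (i : 'I_M.+1) := oapp g t (unlift ord0 i).
have G0 : G ord0 = t by rewrite /G unlift_none.
have GL j : G (lift ord0 j) = g j by rewrite /G liftK.
exists G; rewrite big_ord_recl.
have -> : \sum_(j < M.+1 | j != ord0) f2 (G ord0) (G j) = \sum_(j < M) f2 t (g j).
  rewrite big_mkcond big_ord_recl eqxx /= add0e; apply: eq_bigr => j _.
  by rewrite G0 GL.
have -> : \sum_(i < M) (f1 (G (lift ord0 i)) +
      \sum_(j < M.+1 | j != lift ord0 i) f2 (G (lift ord0 i)) (G j)) =
    \sum_(i < M) (f1 (g i) + (f2 (g i) t + \sum_(j < M | j != i) f2 (g i) (g j))).
  apply: eq_bigr => i _; congr (_ + _); first by rewrite GL.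
  rewrite big_mkcond big_ord_recl /= G0 GL; congr (_ + _).
  rewrite [RHS]big_mkcond; apply: eq_bigr => j _.
  by rewrite (inj_eq lift_inj) GL.
rewrite G0 -addeA -big_split /=.
have -> : \sum_(i < M) (f2 t (g i) + (f1 (g i) + (f2 (g i) t +
      \sum_(j < M | j != i) f2 (g i) (g j)))) =
    \sum_(i < M) (f1' (g i) + \sum_(j < M | j != i) f2 (g i) (g j)).
  apply: eq_bigr => i _; rewrite /f1' !addeA; congr (_ + _).
  by rewrite [f2 t _ + _]addeC -!addeA; congr (_ + _); rewrite addeC.
apply: (le_trans (leeD2l _ hg)).
rewrite (_ : (M%:R * (alpha + fine (A t)) + M%:R * (M%:R - 1) * beta)%:E =
  M%:R%:E * A t + (M%:R * alpha + M%:R * (M%:R - 1) * beta)%:E); last first.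
  by rewrite -[A t in RHS]fineK// -EFinM -EFinD; congr EFin; ring.
rewrite addeA; apply: (le_trans (leeD2r _ ht)).
by rewrite -EFinD lee_fin -natr1 le_eqVlt; apply/orP; left; apply/eqP; ring.
Qed.

End selection.

(** * Random coding *)

Section random_coding.
Variables (R : realType) (p : nat) (c tau : R).
Hypothesis tau0 : 0 < tau.
Local Notation leb := (@lebesgue_measure R).
Local Notation I m := (radint R m).
Local Notation T := (p.+4.+1.-tuple R).
Local Open Scope ereal_scope.

(* [q] is the squared norm of the noise, [s] its component along the codeword. *)
Definition good (q s : R) : bool :=
  (tau * Num.sqrt (q - s ^+ 2) < c + s)%R && (0 < q - s ^+ 2)%R.

Definition chan_out (g z : T) : T := addt (scalet c (dirt g)) z.

(** A null [g] has no direction and is declared atypical, at the price of an event of probability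
    [0]. *)
Definition atypical (g z : T) : bool :=
  (sqnorm g == 0%R) || ~~ good (sqnorm z) (inner z (dirt g)).

(** A tie counts as confusion, to match the strict inequalities of [decoding_region]. *)
Definition confused (g h z : T) : bool :=
  ~~ atypical g z &&
  (inner (dirt g) (chan_out g z) <= inner (dirt h) (chan_out g z))%R.

Definition pr_atypical (g : T) : \bar R := \int[gauss p.+4.+1]_z ((atypical g z)%:R)%:E.

Definition pr_confused (g h : T) : \bar R :=
  \int[gauss p.+4.+1]_z ((confused g h z)%:R)%:E.

(** By rotation invariance, the common value of [pr_atypical g] for all nonnull [g]: [c + u] is the
    output along the codeword, [|a|] the norm of its orthogonal part. *)
Definition mean_atypical : \bar R := ((I p.+3)^-1)%:E *
  \int[stdnormal]_u \int[leb]_a ((radw p.+3 a)%:E *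
    ((~~ ((tau * `|a| < c + u)%R && (a != 0%R)))%:R)%:E).

Lemma measurable_fun_good d (S : measurableType d) (f g : S -> R) :
  measurable_fun setT f -> measurable_fun setT g ->
  measurable_fun setT (fun x => good (f x) (g x)).
Proof. by move=> mf mg; rewrite /good; meast. Qed.

Lemma measurable_fun_atypical d (S : measurableType d) (f g : S -> T) :
  measurable_fun setT f -> measurable_fun setT g ->
  measurable_fun setT (fun x => atypical (f x) (g x)).
Proof.
move=> mf mg; rewrite /atypical; apply: measurable_or; first by meast.
apply: measurable_neg; apply: measurable_fun_good; first by meast.
by apply: measurable_fun_inner => //; exact: measurable_fun_dirt.
Qed.

Lemma measurable_fun_confused d (S : measurableType d) (f g h : S -> T) :
  measurable_fun setT f -> measurable_fun setT g -> measurable_fun setT h ->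
  measurable_fun setT (fun x => confused (f x) (g x) (h x)).
Proof.
move=> mf mg mh; rewrite /confused /chan_out; apply: measurable_and.
  by apply: measurable_neg; exact: measurable_fun_atypical.
have mdf := measurable_fun_dirt mf; have mdg := measurable_fun_dirt mg.
by apply: measurable_fun_ler; apply: measurable_fun_inner => //;
  apply: measurable_fun_addt => //; apply: measurable_fun_scalet => //; meast.
Qed.

Lemma integral_natr_ge0 d (S : measurableType d) (mu : {measure set S -> \bar R})
  (b : S -> bool) : 0 <= \int[mu]_x ((b x)%:R : R)%:E.
Proof. by apply: integral_ge0 => x _; rewrite lee_fin. Qed.

Lemma integral_natr_le1 d (S : measurableType d) (mu : probability S R)
  (b : S -> bool) : measurable_fun setT b -> \int[mu]_x ((b x)%:R : R)%:E <= 1.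
Proof.
move=> mb; rewrite -[leRHS](integral_prob_cst mu).
apply: ge0_le_integralT; [by meast|exact: measurable_cst|by move=> x; rewrite lee_fin|].
by move=> x; rewrite lee_fin lern1 leq_b1.
Qed.

Lemma gauss_sqnorm_eq0 :
  \int[gauss p.+4.+1]_g ((sqnorm g == 0%R)%:R : R)%:E = 0.
Proof.
rewrite (@integral_gauss_radial R p.+4 (fun q => ((q == 0%R)%:R : R)%:E)); last 2 first.
- by meast.
- by move=> q; rewrite lee_fin.
rewrite integral0_eq ?mule0// => a _; rewrite sqrf_eq0.
by have [->|_] := eqVneq a 0%R; rewrite /= ?mule0// /radw normr0 expr0n !mul0r mul0e.
Qed.

Lemma measurable_pr_atypical : measurable_fun setT pr_atypical.
Proof.
apply: measurable_fun_integral; last by move=> *; rewrite lee_fin.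
apply: measurable_fun_EFin; apply: measurable_fun_natr.
by apply: measurable_fun_atypical; meast.
Qed.

Lemma measurable_pr_confused :
  measurable_fun setT (fun x : T * T => pr_confused x.1 x.2).
Proof.
rewrite /pr_confused; apply: measurable_fun_integral; last by move=> *; rewrite lee_fin.
apply: measurable_fun_EFin; apply: measurable_fun_natr.
by apply: measurable_fun_confused; meast.
Qed.

Lemma mean_pr_atypical_le : \int[gauss p.+4.+1]_g pr_atypical g <= mean_atypical.
Proof.
have I0 := radint_gt0 R p.+3.
have m0 : 0 <= mean_atypical by rewrite /mean_atypical; pos.
have ms : measurable_fun setT (fun g : T => ((sqnorm g == 0%R)%:R : R)%:E) by meast.
have -> : mean_atypical = \int[gauss p.+4.+1]_(g in [set: T])
    (((sqnorm g == 0%R)%:R)%:E + mean_atypical).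
  rewrite ge0_integralD; [|by []|by move=> *; rewrite lee_fin|exact: ms|by []|exact: measurable_cst].
  by rewrite gauss_sqnorm_eq0 integral_prob_cst add0e.
apply: ge0_le_integralT; [exact: measurable_pr_atypical| | |].
- by apply: emeasurable_funD => //; exact: measurable_cst.
- by move=> g; exact: integral_natr_ge0.
move=> g; have [g0|g0] := eqVneq (sqnorm g) 0%R.
  apply: le_trans (_ : 1 <= _); last by rewrite leeDl.
  by apply: integral_natr_le1; apply: measurable_fun_atypical; meast.
rewrite add0e /pr_atypical /atypical (negbTE g0) /=.
rewrite (@integral_gauss_polar R p.+3 (dirt g) (fun q s => ((~~ good q s)%:R : R)%:E)); last 2 first.
- by apply: measurable_fun_EFin; apply: measurable_fun_natr; apply: measurable_neg;
    apply: measurable_fun_good; meast.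
- by move=> q s; rewrite lee_fin.
have goodE (u a : R) : good (u ^+ 2 + a ^+ 2) (Num.sqrt (sqnorm (dirt g)) * u) =
    ((tau * `|a| < c + u)%R && (a != 0%R)).
  rewrite /good sqnorm_dirt// sqrtr1 mul1r [(u ^+ 2 + _)%R]addrC addrK sqrtr_sqr.
  by rewrite (lt_def 0%R) sqrf_eq0 sqr_ge0 andbT.
under eq_integral do under eq_integral do rewrite goodE.
exact: lexx.
Qed.

(** For each fixed [g], Tonelli brings the competitor [h] inside: at a typical output it wins with
    the probability of a cap, bounded by [cap_le], and the average over the noise is
    [second_term_le]. *)
Lemma mean_pr_confused_le : \int[gauss p.+4.+1]_g \int[gauss p.+4.+1]_h pr_confused g h <=
  (300 / (p.+1%:R * tau ^+ 2) * (Num.sqrt (1 + tau ^+ 2))^-1 ^+ p.+1)%:E.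
Proof.
have I0 := radint_gt0 R p.+3.
set B := (300 / _ * _)%R.
have mcf g : measurable_fun setT (fun x : T * T => ((confused g x.1 x.2)%:R : R)%:E).
  by apply: measurable_fun_EFin; apply: measurable_fun_natr;
    apply: measurable_fun_confused; meast.
have B0 : 0 <= B%:E.
  by rewrite /B; pos.
rewrite -[leRHS](integral_prob_cst (gauss p.+4.+1)); apply: ge0_le_integralT.
- apply: measurable_fun_integral; first exact: measurable_pr_confused.
  by move=> *; exact: integral_natr_ge0.
- exact: measurable_cst.
- by move=> g; apply: integral_ge0 => h _; exact: integral_natr_ge0.
move=> g.
rewrite (@tonelli _ _ _ _ _ (gauss p.+4.+1) (gauss p.+4.+1)
  (fun h z => ((confused g h z)%:R : R)%:E) (mcf g)); last first.
  by move=> h z; rewrite lee_fin.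
have [g0|g0] := eqVneq (sqnorm g) 0%R.
  rewrite integral0_eq// => z _; rewrite integral0_eq// => h _.
  by rewrite /confused /atypical g0 eqxx.
pose k (q s : R) := confusion p tau (c + s) (Num.sqrt (q - s ^+ 2)).
have k0 q s : 0 <= k q s by exact: confusion_ge0.
have mk : measurable_fun setT (fun x : R * R => k x.1 x.2).
  by apply: measurable_fun_confusion; meast.
have mD : measurable_fun setT (fun _ : T => dirt g) by exact: measurable_cst.
apply: le_trans (_ : \int[gauss p.+4.+1]_z k (sqnorm z) (inner z (dirt g)) <= _).
  apply: ge0_le_integralT.
  - apply: measurable_fun_integral; last by move=> *; rewrite lee_fin.
    by apply: measurable_fun_EFin; apply: measurable_fun_natr;
      apply: measurable_fun_confused; meast.
  - by apply: (measurable_fun2 mk); meast.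
  - by move=> z; exact: integral_natr_ge0.
  move=> z; have [gz|gz] := boolP (good (sqnorm z) (inner z (dirt g))); last first.
    rewrite integral0_eq// => h _.
    by rewrite /confused /atypical gz orbT.
  have := gz; rewrite /good => /andP[]; set q := sqnorm z; set s := inner z _.
  set b := Num.sqrt _ => ts qs.
  have b0 : (0 < b)%R by rewrite sqrtr_gt0.
  have s0 : (0 < c + s)%R by apply: le_lt_trans ts; rewrite mulr_ge0// ltW.
  have dd : inner (dirt g) (dirt g) = 1%R by rewrite innerxx sqnorm_dirt.
  have yE : sqnorm (chan_out g z) = ((c + s) ^+ 2 + b ^+ 2)%R.
    rewrite /b sqr_sqrtr ?ltW// sqnorm_addt sqnorm_scalet inner_scaletl sqnorm_dirt//.
    by rewrite (innerC (dirt g) z) -/s -/q; ring.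
  have := @cap_le R p.+2 (chan_out g z) (c + s) b s0 b0 yE.
  rewrite /k /confusion -/q -/s -/b gtr0_norm// ts gt_eqF// mul1e => /(le_trans _); apply.
  rewrite le_eqVlt; apply/orP; left; apply/eqP; apply: eq_integral => h _.
  rewrite /confused /atypical (negbTE g0) gz /=.
  rewrite {1}/chan_out inner_addtr inner_scaletr dd mulr1 (innerC (dirt g) z).
  by [].
rewrite (@integral_gauss_polar R p.+3 (dirt g) k mk k0).
apply: le_trans (_ : ((I p.+3)^-1)%:E * (I p.+3 * B)%:E <= _); last first.
  by rewrite -EFinM mulKf// gt_eqF.
apply: lee_wpmul2l; first by pos.
apply: le_trans (second_term_le p c tau0).
rewrite le_eqVlt; apply/orP; left; apply/eqP.
apply: eq_integral => u _; apply: eq_integral => a _; congr (_ * _).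
rewrite /k sqnorm_dirt// sqrtr1 mul1r [(u ^+ 2 + _)%R]addrC addrK sqrtr_sqr.
by rewrite /confusion normr_id normr_eq0.
Qed.

End random_coding.

(** * Decoding regions and the union bound *)

Section code_existence.
Variable R : realType.

Lemma measurable_fun_all d (S : measurableType d) (J : Type) (s : seq J)
    (b : J -> S -> bool) : (forall j, measurable_fun setT (b j)) ->
  measurable_fun setT (fun x => all (b^~ x) s).
Proof.
move=> mb; elim: s => [|j s IH] /=; first exact: measurable_cst.
by apply: measurable_and.
Qed.

Lemma measurable_set_of_bool d (S : measurableType d) (b : S -> bool) :
  measurable_fun setT b -> measurable [set x | b x].
Proof.
move=> mb; have := mb measurableT [set true] I; rewrite setTI.
by rewrite (_ : b @^-1` [set true] = [set x | b x]).
Qed.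

Variables (p : nat) (c tau P : R).
Local Notation T := (p.+4.+1.-tuple R).

(* Strict inequalities make the regions disjoint: a tie is an error. *)
Definition decoding_region M (g : 'I_M -> T) (m : 'I_M) : set T :=
  [set y | all (fun k => (k == m) || (inner (dirt (g k)) y < inner (dirt (g m)) y))
             (enum 'I_M)].

Lemma measurable_decoding_region M (g : 'I_M -> T) m :
  measurable (decoding_region g m).
Proof.
apply: measurable_set_of_bool; apply: measurable_fun_all => k.
apply: measurable_or; first exact: measurable_cst.
by apply: measurable_fun_ltr; apply: measurable_fun_inner; meast.
Qed.

Lemma decoding_region_disjoint M (g : 'I_M -> T) m m' : m != m' ->
  decoding_region g m `&` decoding_region g m' = set0.
Proof.
move=> mm'; apply/seteqP; split => // y [/= /allP H /allP H'].
have := H m' (mem_enum _ _); rewrite eq_sym (negbTE mm') /= => l1.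
have := H' m (mem_enum _ _); rewrite (negbTE mm') /= => /(lt_trans l1).
by rewrite ltxx.
Qed.

Local Open Scope ereal_scope.

Lemma error_le M (g : 'I_M -> T) m :
  Wn (scalet c (dirt (g m))) (~` decoding_region g m) <=
  pr_atypical c tau (g m) + \sum_(k < M | k != m) pr_confused c tau (g m) (g k).
Proof.
have mD := measurable_decoding_region g m.
have ma : measurable_fun setT (fun z : T => ((atypical c tau (g m) z)%:R : R)%:E).
  by apply: measurable_fun_EFin; apply: measurable_fun_natr;
    apply: measurable_fun_atypical; meast.
have mc k : measurable_fun setT (fun z : T => ((confused c tau (g m) (g k) z)%:R : R)%:E).
  by apply: measurable_fun_EFin; apply: measurable_fun_natr;
    apply: measurable_fun_confused; meast.
rewrite Wn_gauss; last exact: measurableC.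
rewrite /pr_atypical /pr_confused.
have -> : \sum_(k < M | k != m) \int[gauss p.+4.+1]_z ((confused c tau (g m) (g k) z)%:R : R)%:E =
    \int[gauss p.+4.+1]_z \sum_(k < M | k != m) ((confused c tau (g m) (g k) z)%:R : R)%:E.
  rewrite -big_filter -ge0_integral_sum; [|by []|by move=> k; exact: mc|by move=> *; rewrite lee_fin].
  by apply: eq_integral => z _; rewrite big_filter.
have ms : measurable_fun setT (fun z : T =>
    \sum_(k < M | k != m) ((confused c tau (g m) (g k) z)%:R : R)%:E).
  under eq_fun do rewrite big_mkcond.
  by apply: emeasurable_sum => k; case: (k != m); [exact: mc|exact: measurable_cst].
have s0 (z : T) : 0 <= \sum_(k < M | k != m) ((confused c tau (g m) (g k) z)%:R : R)%:E.
  by apply: sume_ge0 => k _; rewrite lee_fin.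
rewrite -ge0_integralD; [|by []|by move=> *; rewrite lee_fin|exact: ma|
  by move=> z _; exact: s0|exact: ms].
apply: ge0_le_integralT.
- apply: measurable_fun_indic; first exact: measurableC.
  by apply: measurable_fun_addt; meast.
- exact: emeasurable_funD.
- by move=> z; rewrite lee_fin.
move=> z; rewrite indicE; case: (boolP (_ \in _)) => [|_]; last first.
  by rewrite adde_ge0 ?lee_fin// s0.
rewrite inE /= => /negP/allPn[k _]; rewrite negb_or -leNgt => /andP[km kz].
have [a|na] := boolP (atypical c tau (g m) z).
  by rewrite leeDl ?s0.
rewrite add0e (bigD1 k)//= /confused na kz /=.
by rewrite leeDl// sume_ge0// => j _; rewrite lee_fin.
Qed.

Lemma code_existsP M (alpha eps : R) : (0 < M)%N ->
  (c ^+ 2 <= p.+4.+1%:R * P)%R -> (0 < tau)%R ->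
  mean_atypical p c tau < alpha%:E ->
  (alpha + (M%:R - 1) * (300 / (p.+1%:R * tau ^+ 2) *
    (Num.sqrt (1 + tau ^+ 2))^-1 ^+ p.+1) <= eps)%R ->
  code_exists p.+4.+1 M eps P.
Proof.
move=> M0 cP tau0 ha; set B := (300 / _ * _)%R => he.
have M0R : (0 < M%:R :> R)%R by rewrite ltr0n.
have pc1 (x y : T) : pr_confused c tau x y <= 1.
  by apply: integral_natr_le1; apply: measurable_fun_confused; meast.
have [g hg] := @exists_codebook _ _ _ (gauss p.+4.+1) (@pr_confused R p c tau) B
  (@measurable_pr_confused R p c tau)
  (fun x y => integral_natr_ge0 _ _)
  pc1
  (@mean_pr_confused_le R p c tau tau0)
  M (@pr_atypical R p c tau) alpha (@measurable_pr_atypical R p c tau)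
  (fun x => integral_natr_ge0 _ _)
  (le_lt_trans (@mean_pr_atypical_le R p c tau) ha).
split=> //; exists (fun m => scalet c (dirt (g m))), (decoding_region g); split.
- move=> m; rewrite sqnorm_scalet; apply: le_trans cP.
  by rewrite ler_piMr ?sqr_ge0// sqnorm_dirt_le1.
- by move=> m; exact: measurable_decoding_region.
- by move=> m m'; exact: decoding_region_disjoint.
apply: le_trans (_ : ((M%:R)^-1)%:E * (M%:R * alpha + M%:R * (M%:R - 1) * B)%:E <= _).
  apply: lee_wpmul2l; first by rewrite lee_fin invr_ge0 ltW.
  apply: le_trans hg; apply: lee_sum => m _; exact: error_le.
rewrite -EFinM lee_fin; apply: le_trans he.
by rewrite le_eqVlt; apply/orP; left; apply/eqP; field; rewrite gt_eqF.
Qed.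

End code_existence.

(** * Normal approximation of the radial law *)

Section log_taylor.
Variable R : realType.

(** One mean value argument for the four bounds below: they take [k = 0], [1/3] or [1], for which
    the derivative [y ^+ 2 / (1 + y) - 3 k y ^+ 2] has a known sign on the relevant side of [0]. *)
Lemma ln_taylor_mvt (k x : R) : -1 < x -> x != 0 -> exists y,
  [/\ y != 0, Num.min 0 x <= y, y <= Num.max 0 x &
  ln (1 + x) - (x - x ^+ 2 / 2 + k * x ^+ 3) = (y ^+ 2 / (1 + y) - 3 * k * y ^+ 2) * x].
Proof.
move=> x1 x0.
pose f (y : R) := ln (1 + y) - (y - y ^+ 2 / 2 + k * y ^+ 3).
pose df (y : R) := y ^+ 2 / (1 + y) - 3 * k * y ^+ 2.
have dfE (y : R) : -1 < y -> is_derive y 1 f (df y).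
  move=> y1; have y10 : 0 < 1 + y by rewrite -ltrBlDl sub0r.
  have H1 : is_derive y 1 (fun a : R => 1 + a) 1.
    by apply: is_derive_eq; rewrite add0r mulr1.
  have H2 := @is_derive1_comp R (@ln R) (fun a : R => 1 + a) y _ _
    (is_derive1_ln y10) H1.
  have H3 : is_derive y 1 (fun a : R => a - 2^-1 * a ^+ 2 + k * a ^+ 3)
      (1 - y + 3 * k * y ^+ 2).
    by apply: is_derive_eq; rewrite /GRing.scale /=; field.
  have fE : (@ln R \o (fun a : R => 1 + a)) - (fun a : R => a - 2^-1 * a ^+ 2 + k * a ^+ 3) = f.
    by apply/funext => a; rewrite /f !fctE /=; congr (_ - _); ring.
  have dE : (1 + y)^-1 * 1 - (1 - y + 3 * k * y ^+ 2) = df y.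
    by rewrite /df; field; rewrite gt_eqF.
  by have := is_deriveB H2 H3; rewrite fE dE.
have cf (a b : R) : -1 < a -> {within `[a, b], continuous f}.
  move=> a1; apply: continuous_in_subspaceT => y; rewrite inE /= in_itv /= => /andP[ay _].
  have := dfE y (lt_le_trans a1 ay) => -[d _].
  by apply: differentiable_continuous; apply/derivable1_diffP.
have f0 : f 0 = 0 by rewrite /f addr0 ln1 !expr0n /=; ring.
have [x_gt0|x_le0] := ltP 0 x.
  have [y||y] := @MVT R f df 0 x x_gt0.
  - rewrite in_itv /= => /andP[y0 _]; apply: dfE.
    by apply: lt_trans y0; rewrite oppr_lt0.
  - by apply: cf; rewrite oppr_lt0.
  rewrite in_itv /= => /andP[y0 yx]; rewrite f0 !subr0 => E.
  by exists y; split; rewrite ?gt_eqF ?(ltW y0) ?(ltW yx)// ltW.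
have x_lt0 : x < 0 by rewrite lt_neqAle x0.
have [y||y] := @MVT R f df x 0 x_lt0.
- by rewrite in_itv /= => /andP[xy _]; apply: dfE; exact: lt_trans xy.
- exact: cf.
rewrite in_itv /= => /andP[xy y0]; rewrite f0 !sub0r mulrN => /oppr_inj E.
by exists y; split; rewrite ?lt_eqF ?(ltW y0) ?(ltW xy)// ltW.
Qed.

Lemma ln1D_ge (x : R) : 0 <= x -> x - x ^+ 2 / 2 <= ln (1 + x).
Proof.
move=> x_ge0; have [->|x0] := eqVneq x 0; first by rewrite addr0 ln1 expr0n mul0r subr0.
have x1 : -1 < x by apply: lt_le_trans x_ge0; rewrite oppr_lt0.
have [y []] := ln_taylor_mvt 0 x1 x0; rewrite min_l// max_r// => _ y0 _.
rewrite mulr0 !mul0r addr0 subr0 => E; rewrite -subr_ge0 E.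
by rewrite mulr_ge0// divr_ge0 ?sqr_ge0// addr_ge0.
Qed.

Lemma ln1D_le_neg (x : R) : -1 < x -> x <= 0 -> ln (1 + x) <= x - x ^+ 2 / 2.
Proof.
move=> x1 x_le0; have [->|x0] := eqVneq x 0; first by rewrite addr0 ln1 expr0n mul0r subr0.
have [y []] := ln_taylor_mvt 0 x1 x0; rewrite min_r// max_l// => _ xy y0.
rewrite mulr0 !mul0r addr0 subr0 => E; rewrite -subr_le0 E.
rewrite mulr_ge0_le0// divr_ge0 ?sqr_ge0//.
by rewrite -lerBlDl sub0r ltW// (lt_le_trans x1).
Qed.

Lemma ln1D_le_pos (x : R) : 0 <= x -> ln (1 + x) <= x - x ^+ 2 / 2 + x ^+ 3 / 3.
Proof.
move=> x_ge0; have [->|x0] := eqVneq x 0.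
  by rewrite addr0 ln1 !expr0n /= !mul0r subr0 addr0.
have x1 : -1 < x by apply: lt_le_trans x_ge0; rewrite oppr_lt0.
have [y []] := ln_taylor_mvt 3^-1 x1 x0; rewrite min_l// max_r// => _ y0 _.
rewrite [3^-1 * _]mulrC => E; rewrite -subr_le0 E mulr_le0_ge0//.
rewrite divff// mul1r subr_le0 ler_piMr ?sqr_ge0// invf_le1 ?lerDl//.
by rewrite ltr_pwDl.
Qed.

Lemma ln1D_ge_neg (x : R) : - 2^-1 <= x -> x <= 0 ->
  x - x ^+ 2 / 2 + x ^+ 3 <= ln (1 + x).
Proof.
move=> x2 x_le0; have [->|x0] := eqVneq x 0.
  by rewrite addr0 ln1 !expr0n /= !mul0r subr0 addr0.
have x1 : -1 < x by apply: lt_le_trans x2; rewrite ltrN2 invf_lt1 ?ltr1n.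
have [y []] := ln_taylor_mvt 1 x1 x0; rewrite min_r// max_l// => _ xy _.
rewrite mul1r => E; rewrite -subr_ge0 E mulr_le0// mulr1 subr_le0 mulrC.
rewrite ler_wpM2r ?sqr_ge0//.
have y2 : 2^-1 <= 1 + y by lra.
rewrite (le_trans (_ : _ <= 2))// ?ler_nat//.
by rewrite -[leRHS]invrK lef_pV2// posrE ?invr_gt0//; lra.
Qed.

End log_taylor.

Section radial_shift.
Variable R : realType.

(* [radw m (r + s)] on [r + s > 0], divided by its value at [s = 0], where
   [r = sqrt m]. *)
Definition rpdf (m : nat) (r s : R) : R :=
  (0 < r + s)%R%:R * ((1 + s / r) ^+ m * expR (- (r * s) - s ^+ 2 / 2)).

Variables (m : nat) (r : R).
Hypotheses (r0 : 0 < r) (r2 : r ^+ 2 = m%:R).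

(** Since [m = r ^+ 2], the linear terms cancel and the quadratic ones add up, half of [s ^+ 2] from
    the logarithm and half from the exponential: hence a limit of variance 1/2. *)
Lemma rpdf_exp (s : R) : 0 < r + s -> rpdf m r s =
  expR (m%:R * (ln (1 + s / r) - (s / r - (s / r) ^+ 2 / 2)) - s ^+ 2).
Proof.
move=> rs; rewrite /rpdf rs mul1r.
have x0 : 0 < 1 + s / r.
  by rewrite -(pmulr_rgt0 _ r0) mulrDr mulr1 mulrCA divff ?gt_eqF// mulr1.
rewrite -[in LHS](lnK x0) -expRM_natl -expRD; congr expR.
by rewrite -r2; field; rewrite gt_eqF.
Qed.

(** For [s <= 0] the remainder [E] in the exponent is nonpositive. For [s > 0], [1 - E <= exp (- E)]
    leaves an error [E exp (E - s^2)], where [E <= s^3 / r] and [ln (1 + x) <= x] saves half of the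
    Gaussian exponent. *)
Lemma rpdf_le (s : R) :
  rpdf m r s <= expR (- s ^+ 2) + `|s| ^+ 3 / r * expR (- s ^+ 2 / 2).
Proof.
have h0 : 0 <= `|s| ^+ 3 / r * expR (- s ^+ 2 / 2).
  by rewrite mulr_ge0 ?expR_ge0// divr_ge0 ?exprn_ge0// ltW.
have [rs|rs] := ltP 0 (r + s); last first.
  by rewrite /rpdf ltNge rs mul0r addr_ge0 ?expR_ge0.
rewrite rpdf_exp//; set x := s / r.
have x1 : -1 < x by rewrite /x ltr_pdivlMr// mulN1r -subr_gt0 opprK addrC.
have sx : s = r * x by rewrite /x mulrCA divff ?gt_eqF// mulr1.
have [x0|x0] := leP x 0.
  apply: le_trans (_ : expR (- s ^+ 2) <= _); last by rewrite lerDl.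
  rewrite ler_expR gerDr mulr_ge0_le0// subr_le0; exact: ln1D_le_neg.
have s0 : 0 < s by rewrite sx mulr_gt0.
set E := _ * _; have E1 : E <= `|s| ^+ 3 / r.
  rewrite gtr0_norm// {1}sx (_ : (r * x) ^+ 3 / r = m%:R * x ^+ 3); last first.
    by rewrite -r2; field; rewrite gt_eqF.
  apply: ler_wpM2l => //; have := ln1D_le_pos (ltW x0).
  have : 0 <= x ^+ 3 by rewrite exprn_ge0// ltW.
  lra.
have E2 : E - s ^+ 2 <= - s ^+ 2 / 2.
  rewrite /E (_ : - s ^+ 2 / 2 = m%:R * (x ^+ 2 / 2) - s ^+ 2); last first.
    by rewrite {1 2}sx exprMn -r2; field.
  rewrite lerD2r ler_wpM2l//; have := le_ln1Dx x1; lra.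
have E0 : 0 <= E.
  by rewrite /E mulr_ge0// subr_ge0; exact: ln1D_ge (ltW x0).
apply: le_trans (_ : expR (- s ^+ 2) + E * expR (E - s ^+ 2) <= _); last first.
  by rewrite lerD2l; apply: ler_pM => //; rewrite ler_expR.
have := expR_ge1Dx (- E); rewrite -(ler_pM2r (expR_gt0 (E - s ^+ 2))) -expRD.
by rewrite addrA addNr add0r mulrDl mul1r mulNr lerBlDr.
Qed.

(** The 8 is [2 ^ 3]: either the error term alone dominates, or [|s / r| < 1/2], where the cubic
    lower bound on the logarithm holds and [1 + x <= exp x] concludes. *)
Lemma rpdf_ge (s : R) : (0 < m)%N ->
  expR (- s ^+ 2) <= rpdf m r s + 8 * (`|s| ^+ 3 / r * expR (- s ^+ 2 / 2)).
Proof.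
move=> m0; set h := `|s| ^+ 3 / r.
have h0 : 0 <= h by rewrite divr_ge0 ?exprn_ge0// ltW.
have e2 : expR (- s ^+ 2) <= expR (- s ^+ 2 / 2).
  by rewrite ler_expR; have := sqr_ge0 s; lra.
have p0 : 0 <= rpdf m r s.
  have [rs|rs] := ltP 0 (r + s); first by rewrite rpdf_exp ?expR_ge0.
  by rewrite /rpdf ltNge rs mul0r.
have [h8|h8] := leP 1 (8 * h).
  apply: le_trans (_ : 8 * (h * expR (- s ^+ 2 / 2)) <= _); last by rewrite lerDr.
  by rewrite mulrA (le_trans e2)// ler_peMl ?expR_ge0.
set x := s / r.
have sx : s = r * x by rewrite /x mulrCA divff ?gt_eqF// mulr1.
have hE : h = m%:R * `|x| ^+ 3.
  by rewrite /h sx normrM (gtr0_norm r0) -r2; field; rewrite gt_eqF.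
have nx : `|x| < 2^-1.
  rewrite ltNge; apply/negP => x2; move: h8; rewrite ltNge => /negP; apply.
  have : 8^-1 <= `|x| ^+ 3.
    apply: le_trans (_ : (2^-1) ^+ 3 <= _); last by rewrite lerXn2r ?nnegrE.
    by rewrite exprVn -natrX.
  have : 1 <= m%:R :> R by rewrite ler1n.
  have : 0 <= `|x| ^+ 3 by rewrite exprn_ge0.
  rewrite hE; nra.
have /andP[x2 x3] : (- 2^-1 < x) && (x < 2^-1) by rewrite -ltr_norml.
have rs : 0 < r + s.
  by rewrite sx -[X in X + _]mulr1 -mulrDr mulr_gt0//; lra.
rewrite rpdf_exp// -/x; set E := _ * _.
have EE : - h <= E.
  have [x0|x0] := leP x 0.
    rewrite hE /E -mulrN ler_wpM2l// ler0_norm//.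
    have := ln1D_ge_neg (ltW x2) x0; rewrite exprNn; lra.
  apply: le_trans (_ : 0 <= _); first by rewrite oppr_le0.
  by rewrite /E mulr_ge0// subr_ge0; exact: ln1D_ge (ltW x0).
apply: le_trans (_ : (1 + E + h) * expR (- s ^+ 2) <= _).
  by rewrite ler_peMl ?expR_ge0//; lra.
rewrite mulrDl; apply: lerD.
  by rewrite expRD ler_wpM2r ?expR_ge0// expR_ge1Dx.
have := ler_wpM2l h0 e2; have : 0 <= h * expR (- s ^+ 2 / 2) by rewrite mulr_ge0 ?expR_ge0.
lra.
Qed.

End radial_shift.

Section normal_cdf.
Variable R : realType.
Local Notation leb := (@lebesgue_measure R).
Local Open Scope ereal_scope.

Lemma PhiE (t : R) : (Phi t)%:E = \int[stdnormal]_u ((u <= t)%R%:R : R)%:E.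
Proof.
have fin : \int[stdnormal]_u ((u <= t)%R%:R : R)%:E \is a fin_num.
  rewrite ge0_fin_numE ?integral_natr_ge0//.
  apply: le_lt_trans (ltry 1); apply: integral_natr_le1; by meast.
rewrite -(fineK fin) /Phi /Rintegral; congr (fine _)%:E.
rewrite integral_stdnormal; [|by meast|by move=> *; rewrite lee_fin].
rewrite [LHS]integral_mkcond; apply: eq_integral => u _.
rewrite patchE mem_setE /= in_itv /=.
by case: (u <= t)%R; rewrite ?mule1 ?mule0.
Qed.

Lemma Phi_ge0 (t : R) : (0 <= Phi t)%R.
Proof. by rewrite -lee_fin PhiE integral_natr_ge0. Qed.

Lemma Phi_le1 (t : R) : (Phi t <= 1)%R.
Proof. by rewrite -lee_fin PhiE; apply: integral_natr_le1; meast. Qed.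

End normal_cdf.

Section first_term.
Variable R : realType.
Local Notation leb := (@lebesgue_measure R).
Local Notation I m := (radint R m).
Local Notation kappa := (Num.sqrt (2 * pi : R) / Num.sqrt 2)%R.
Local Open Scope ereal_scope.

Lemma integral_even (F : R -> \bar R) : measurable_fun setT F -> (forall a, 0 <= F a) ->
  F 0%R = 0 -> (forall a, F (- a)%R = F a) ->
  \int[leb]_a F a = 2%:E * \int[leb]_a (((0 < a)%R%:R)%:E * F a).
Proof.
move=> mF F0 F00 Fe.
have mp : measurable_fun setT (fun a : R => ((0 < a)%R%:R)%:E * F a) by meast.
have mn : measurable_fun setT (fun a : R => ((0 < - a)%R%:R)%:E * F (- a)%R) by meast.
transitivity (\int[leb]_a (((0 < a)%R%:R)%:E * F a + ((0 < - a)%R%:R)%:E * F (- a)%R)).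
  apply: eq_integral => a _; rewrite Fe oppr_gt0.
  case: (ltgtP 0%R a) => [a0|a0|<-]; last by rewrite F00 !mule0 adde0.
    by rewrite mul1e mul0e adde0.
  by rewrite mul1e mul0e add0e.
rewrite ge0_integralD; [|by []|by move=> *; rewrite mule_ge0// lee_fin|exact: mp|
  by move=> *; rewrite mule_ge0// lee_fin|exact: mn].
rewrite (integral_opp mp); last by move=> *; rewrite mule_ge0// lee_fin.
by rewrite -[2%R]/(1 + 1)%R EFinD ge0_muleDl// mul1e.
Qed.

(** [kappa] is [sqrt pi], the integral of [exp (- s ^+ 2)]. *)
Lemma kappa_ge1 : (1 <= kappa)%R.
Proof.
rewrite -(@expr_ge1 _ 2)//.
rewrite exprMn exprVn !sqr_sqrtr//; last by rewrite mulr_ge0// pi_ge0.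
by rewrite mulrAC divff// mul1r; have := pi_ge2 R; lra.
Qed.

Lemma integral_gauss_sqrt2 (f : R -> \bar R) :
  measurable_fun setT f -> (forall v, 0 <= f v) ->
  \int[leb]_s ((expR (- s ^+ 2))%:E * f (Num.sqrt 2 * s)%R) =
  kappa%:E * \int[stdnormal]_v f v.
Proof.
move=> mf f0; have s20 : (Num.sqrt 2 != 0 :> R)%R by rewrite gt_eqF// sqrtr_gt0.
have w0 : (0 < Num.sqrt (2 * pi : R))%R by rewrite sqrtr_gt0 mulr_gt0// pi_gt0.
rewrite integral_stdnormal//.
have mWf : measurable_fun setT (fun v : R => (W v 0)%:E * f v) by meast.
have Wf0 (v : R) : 0 <= (W v 0)%:E * f v by rewrite mule_ge0// lee_fin W_ge0.
rewrite [kappa]mulrC mulrC EFinM -muleA.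
have -> : ((Num.sqrt 2 : R)^-1)%:E = (`|Num.sqrt 2 : R|^-1)%:E by rewrite ger0_norm.
rewrite -(integral_scale s20 mWf Wf0) -ge0_integralZl; side.
apply: eq_integral => s _; rewrite muleA -EFinM; congr (_%:E * _).
rewrite /W subr0 mulrA divff ?gt_eqF// mul1r; congr expR.
by rewrite exprMn sqr_sqrtr//; field.
Qed.

(** The variable [u - tau v / sqrt 2] is centred normal of variance [1 + tau ^+ 2 / 2]: noise along
    the codeword plus fluctuation of the orthogonal norm. At [tau = sqrt P] this variance produces
    the dispersion. *)
Lemma integral_shifted_cdf (c tau r : R) : (0 < tau)%R ->
  \int[stdnormal]_v \int[stdnormal]_u
    ((c + u <= tau * (r + v / Num.sqrt 2))%R%:R : R)%:E =
  (Phi ((tau * r - c) / Num.sqrt (1 + tau ^+ 2 / 2)))%:E.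
Proof.
move=> tau0.
pose h (q x : R) : \bar R := ((x <= tau * r - c)%R%:R : R)%:E.
have mh : measurable_fun setT (fun x : R * R => h x.1 x.2) by rewrite /h; meast.
have h0 q x : 0 <= h q x by rewrite /h lee_fin.
have := @stdnormal_rotation R h (- (tau / Num.sqrt 2)) 1 mh h0.
have -> : ((- (tau / Num.sqrt 2)) ^+ 2 + 1 ^+ 2 = 1 + tau ^+ 2 / 2)%R.
  by rewrite sqrrN expr1n exprMn exprVn sqr_sqrtr// addrC.
move=> H.
transitivity (\int[stdnormal]_u \int[stdnormal]_v h (u ^+ 2 + v ^+ 2)%R (- (tau / Num.sqrt 2) * u + 1 * v)%R).
  apply: eq_integral => v _; apply: eq_integral => u _; rewrite /h.
  congr ((nat_of_bool _)%:R%:E); rewrite mul1r -[LHS]subr_ge0 -[RHS]subr_ge0.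
  by congr (0 <= _)%R; field; rewrite gt_eqF// sqrtr_gt0.
rewrite H PhiE; apply: eq_integral => u _; rewrite /h integral_prob_cst.
by rewrite ler_pdivlMr ?sqrtr_gt0 ?ltr_pwDl ?divr_ge0 ?sqr_ge0// mulrC.
Qed.

End first_term.

(** * The probability of an atypical output *)

Section mean_atypical_bound.
Variables (R : realType) (p : nat) (c tau : R).
Hypothesis tau0 : 0 < tau.
Local Notation leb := (@lebesgue_measure R).
Local Notation I m := (radint R m).
Local Notation kappa := (Num.sqrt (2 * pi : R) / Num.sqrt 2).
Local Notation r := (Num.sqrt (p.+3%:R : R)).
Local Notation m := p.+3.
Local Notation PhiX := (Phi ((tau * r - c) / Num.sqrt (1 + tau ^+ 2 / 2))).
Local Open Scope ereal_scope.

(* The probability that a noise whose component orthogonal to the codeword has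
   norm [t] is atypical. *)
Definition cut (t : R) : \bar R :=
  \int[stdnormal]_u ((c + u <= tau * t)%R%:R : R)%:E.

Lemma measurable_fun_cut d (T : measurableType d) (f : T -> R) :
  measurable_fun setT f -> measurable_fun setT (fun x => cut (f x)).
Proof.
move=> mf; rewrite /cut; apply: measurable_fun_integral; first by meast.
by move=> *; rewrite lee_fin.
Qed.

Lemma cut_ge0 t : 0 <= cut t.
Proof. exact: integral_natr_ge0. Qed.

Lemma cut_le1 t : cut t <= 1.
Proof. by apply: integral_natr_le1; meast. Qed.

Lemma radw_shift (s : R) :
  ((0 < s + r)%R%:R * radw m (s + r) = (r ^+ m * expR (- r ^+ 2 / 2)) * rpdf m r s)%R.
Proof.
have r0 : (0 < r)%R by rewrite sqrtr_gt0.
rewrite /rpdf addrC; case: ltP => [rs|_]; last by rewrite !mul0r mulr0.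
rewrite !mul1r /radw gtr0_norm// mulrACA -expRD -exprMn; congr (_ ^+ _ * expR _)%R.
  by field; rewrite gt_eqF.
by field.
Qed.

Lemma radial_half (g : R -> \bar R) : measurable_fun setT g -> (forall t, 0 <= g t) ->
  \int[leb]_a ((radw m a)%:E * g `|a|%R) =
  (2 * (r ^+ m * expR (- r ^+ 2 / 2)))%:E *
    \int[leb]_s ((rpdf m r s)%:E * g (s + r)%R).
Proof.
move=> mg g0; set K := (r ^+ m * _)%R.
have K0 : (0 <= K)%R by rewrite mulr_ge0 ?expR_ge0// exprn_ge0// sqrtr_ge0.
have rpdf0 s : (0 <= rpdf m r s)%R.
  have := radw_shift s; rewrite -/K => E.
  rewrite /rpdf; case: ltP => [rs|_]; last by rewrite mul0r.
  rewrite mul1r mulr_ge0 ?expR_ge0// exprn_ge0//.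
  have r0 : (0 < r)%R by rewrite sqrtr_gt0.
  by rewrite -(pmulr_rge0 _ r0) mulrDr mulr1 mulrCA divff ?gt_eqF// mulr1 ltW.
have mr : measurable_fun setT (fun s => rpdf m r s) by rewrite /rpdf; meast.
rewrite integral_even; last 4 first.
- by meast.
- by move=> a; rewrite mule_ge0// lee_fin radw_ge0.
- by rewrite /radw normr0 expr0n mul0r mul0e.
- by move=> a; rewrite /radw normrN sqrrN.
rewrite EFinM -muleA; congr (_ * _).
have mF : measurable_fun setT (fun a : R => ((0 < a)%R%:R)%:E * ((radw m a)%:E * g a)) by meast.
have F0 (a : R) : 0 <= ((0 < a)%R%:R)%:E * ((radw m a)%:E * g a).
  by rewrite !mule_ge0// lee_fin ?radw_ge0.
transitivity (\int[leb]_a (((0 < a)%R%:R)%:E * ((radw m a)%:E * g a))).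
  apply: eq_integral => a _; case: (ltP 0%R a) => [a0|_]; last by rewrite !mul0e.
  by rewrite gtr0_norm.
rewrite -(integral_shift r mF F0) -ge0_integralZl; [|by []| |
  by move=> s _; rewrite mule_ge0 ?lee_fin|by rewrite lee_fin]; last first.
  by apply: emeasurable_funM; meast.
apply: eq_integral => s _; rewrite !muleA -!EFinM; congr (_%:E * _).
exact: radw_shift.
Qed.

Lemma mean_atypical_cut : mean_atypical p c tau =
  ((I m)^-1)%:E * \int[leb]_a ((radw m a)%:E * cut `|a|%R).
Proof.
rewrite /mean_atypical; congr (_ * _).
rewrite tonelli; last 2 first.
- by meast.
- by move=> u a; rewrite mule_ge0// lee_fin ?radw_ge0.
apply: eq_integral => a _.
rewrite ge0_integralZl; [|by []|by meast|by move=> *; rewrite lee_fin|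
  by rewrite lee_fin radw_ge0].
have [->|a0] := eqVneq a 0%R.
  by rewrite /radw normr0 expr0n mul0r !mul0e.
congr (_ * _); apply: eq_integral => u _; rewrite andbT.
by rewrite -leNgt.
Qed.

(** Let [y = I 3 / r]. The normalisation [j] is at least [kappa - 8 y] by [rpdf_ge], the numerator
    at most [kappa PhiX + y] by [rpdf_le], so the quotient is at most [PhiX + 9 y / j]; [16 y <= 1]
    gives [j >= 1/2], hence the 18. *)
Lemma mean_atypical_le : (16 * I 3 <= r)%R ->
  mean_atypical p c tau <= (PhiX + 18 * I 3 / r)%:E.
Proof.
move=> hr; have r0 : (0 < r)%R by rewrite sqrtr_gt0.
have r2 : (r ^+ 2 = m%:R)%R by rewrite sqr_sqrtr.
have i0 := radint_gt0 R m; have i3 := radint_gt0 R 3.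
set K := (2 * (r ^+ m * expR (- r ^+ 2 / 2)))%R.
have K0 : (0 < K)%R by rewrite mulr_gt0// mulr_gt0 ?expR_gt0// exprn_gt0.
have mcut : measurable_fun setT cut by apply: measurable_fun_cut; meast.
have mr : measurable_fun setT (fun s => rpdf m r s) by rewrite /rpdf; meast.
have rpdf0 s : (0 <= rpdf m r s)%R.
  have [rs|rs] := ltP 0%R (r + s)%R; first by rewrite rpdf_exp ?expR_ge0.
  by rewrite /rpdf ltNge rs mul0r.
pose J := \int[leb]_s (rpdf m r s)%:E.
pose j := (I m / K)%R.
have j0 : (0 < j)%R by rewrite divr_gt0.
have JE : J = j%:E.
  have mc1 : measurable_fun setT (fun _ : R => 1 : \bar R) by meast.
  have := radial_half mc1 (fun _ => lee01).
  under eq_integral do rewrite mule1.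
  under [in RHS]eq_integral do rewrite mule1.
  rewrite integral_radw -/J -/K => E.
  by rewrite /j mulrC EFinM E muleA -EFinM mulVf ?gt_eqF// mul1e.
have E1 : kappa%:E <= (j + 8 * I 3 / r)%:E.
  rewrite -[kappa%:E]mule1 -[X in _ * X <= _](integral_prob_cst (@stdnormal R) 1).
  rewrite -(@integral_gauss_sqrt2 R (fun _ => 1)); [|by meast|by []].
  under eq_integral do rewrite mule1.
  rewrite EFinD -JE (_ : 8 * I 3 / r = (8 / r) * I 3)%R; last by ring.
  rewrite EFinM -integral_radw -ge0_integralZl; side.
  rewrite /J -ge0_integralD; [|by []|by move=> *; rewrite lee_fin|by meast|
    by move=> *; pos|by meast].
  apply: ge0_le_integralT; [by meast| |by move=> s; rewrite lee_fin expR_ge0|].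
    by apply: emeasurable_funD; meast.
  move=> s; rewrite -EFinM -EFinD lee_fin.
  apply: le_trans (rpdf_ge r0 r2 s _) _ => //.
  by rewrite lerD2l /radw le_eqVlt; apply/orP; left; apply/eqP; ring.
have E2 : \int[leb]_s ((rpdf m r s)%:E * cut (s + r)%R) <=
    (kappa * PhiX + I 3 / r)%:E.
  rewrite EFinD [(kappa * _)%:E]EFinM -(integral_shifted_cdf c r tau0).
  rewrite -[X in kappa%:E * X](_ : \int[stdnormal]_v cut (r + v / Num.sqrt 2)%R = _)//.
  have mc : measurable_fun setT (fun v : R => cut (r + v / Num.sqrt 2)%R).
    by apply: measurable_fun_cut; meast.
  rewrite -(integral_gauss_sqrt2 mc (fun _ => cut_ge0 _)).
  rewrite mulrC EFinM -integral_radw -ge0_integralZl; side.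
  rewrite -ge0_integralD; [|by []| | |by move=> *; pos|by meast]; last 2 first.
  - by move=> s _; rewrite mule_ge0 ?cut_ge0// lee_fin expR_ge0.
  - by apply: emeasurable_funM; [meast|apply: measurable_fun_cut; meast].
  apply: ge0_le_integralT.
  - by apply: emeasurable_funM; [meast|apply: measurable_fun_cut; meast].
  - apply: emeasurable_funD; last by meast.
    by apply: emeasurable_funM; [meast|apply: measurable_fun_cut; meast].
  - by move=> s; rewrite mule_ge0 ?cut_ge0 ?lee_fin.
  move=> s; have -> : (r + Num.sqrt 2 * s / Num.sqrt 2 = s + r)%R.
    by rewrite mulrAC divff ?gt_eqF ?sqrtr_gt0// mul1r addrC.
  apply: le_trans (_ : (expR (- s ^+ 2) + `|s| ^+ 3 / r * expR (- s ^+ 2 / 2))%:E * cut (s + r)%R <= _).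
    by apply: lee_wpmul2r; [exact: cut_ge0|rewrite lee_fin; exact: rpdf_le].
  rewrite EFinD ge0_muleDl; [|by rewrite lee_fin expR_ge0|by pos].
  apply: leeD2l; rewrite -EFinM /radw.
  have -> : (r^-1 * (`|s| ^+ 3 * expR (- s ^+ 2 / 2)) = `|s| ^+ 3 / r * expR (- s ^+ 2 / 2))%R by ring.
  by rewrite -[leRHS]mule1; apply: lee_wpmul2l; [pos|exact: cut_le1].
rewrite mean_atypical_cut radial_half; [|exact: mcut|exact: cut_ge0].
rewrite -/K muleA -EFinM.
have -> : ((I m)^-1 * K = j^-1)%R by rewrite /j invf_div mulrC.
apply: le_trans (_ : (j^-1)%:E * (kappa * PhiX + I 3 / r)%:E <= _).
  by apply: lee_wpmul2l => //; rewrite lee_fin invr_ge0 ltW.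
rewrite -EFinM lee_fin; move: E1; rewrite lee_fin => E1.
have F0 := Phi_ge0 ((tau * r - c) / Num.sqrt (1 + tau ^+ 2 / 2)).
have F1 := Phi_le1 ((tau * r - c) / Num.sqrt (1 + tau ^+ 2 / 2)).
move: F0 F1; set F := PhiX => F0 F1.
have k1 := kappa_ge1 R.
rewrite mulrC ler_pdivrMr//.
pose y := (I 3 / r)%R.
have y0 : (0 <= y)%R by rewrite /y divr_ge0 ?(ltW i3) ?(ltW r0).
have y1 : (16 * y <= 1)%R by rewrite /y mulrA ler_pdivrMr// mul1r.
have -> : (18 * I 3 / r = 18 * y)%R by rewrite /y mulrA.
have {}E1 : (kappa <= j + 8 * y)%R by rewrite /y mulrA.
rewrite -/y; clearbody y F.
have j2 : (2^-1 <= j)%R by lra.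
nra.
Qed.

End mean_atypical_bound.

(** * The normal quantile *)

Section quantile.
Variable R : realType.
Local Notation leb := (@lebesgue_measure R).

Lemma Phi_mono (a b : R) : a <= b -> Phi a <= Phi b.
Proof.
move=> ab; rewrite -lee_fin !PhiE; apply: ge0_le_integralT.
- by meast.
- by meast.
- by move=> u; rewrite lee_fin.
- by move=> u; rewrite lee_fin ler_nat; case: (leP u a) => // /le_trans ->.
Qed.

Lemma Phi_tail_le (t : R) : 1 <= t -> Phi (- t) <= t^-1.
Proof.
move=> t1; have t0 : 0 < t by exact: lt_le_trans ltr01 t1.
have m1 : measurable_fun setT (fun u : R => (((- u <= - t)%R%:R : R)%:E : \bar R)) by meast.
have m2 : measurable_fun setT (fun u : R => (((u <= - t)%R%:R : R)%:E : \bar R)) by meast.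
rewrite -lee_fin PhiE -(stdnormal_opp m2) => [|u]; last by rewrite lee_fin.
under eq_integral do rewrite lerN2.
apply: le_trans (stdnormal_tail_le t0) _; rewrite lee_fin.
rewrite -[leRHS]mul1r invfM mulrA ler_wpM2r ?invr_ge0 ?(ltW t0)//.
rewrite mulr_ile1 ?expR_ge0 ?invr_ge0//.
  by rewrite expR_le1 oppr_le0 divr_ge0// sqr_ge0.
rewrite invf_le1 ?sqrtr_gt0 ?mulr_gt0 ?pi_gt0//.
by rewrite -[leLHS]sqrtr1 ler_wsqrtr//; have := pi_ge2 R; lra.
Qed.

(** [Phiinv] is an infimum, which bounds its set from below only if that set has a lower bound; the
    tail bound provides [- (1 + eps^-1)]. *)
Lemma Phi_lt_of_lt_Phiinv (eps t : R) : 0 < eps -> t < Phiinv eps -> Phi t < eps.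
Proof.
move=> e0 ht; rewrite ltNge; apply/negP => et; move: ht; rewrite ltNge => /negP; apply.
apply: ge_inf => //.
exists (- (1 + eps^-1)) => s /= es; rewrite leNgt; apply/negP => hs.
have h1 : 1 <= 1 + eps^-1 by rewrite lerDl invr_ge0 ltW.
have := le_trans (le_trans es (Phi_mono (ltW hs))) (Phi_tail_le h1).
apply/negP; rewrite -ltNge -[ltRHS]invrK ltf_pV2 ?posrE ?invr_gt0//.
  by rewrite ltrDr.
by apply: lt_le_trans h1.
Qed.

Lemma Phi_increment (a b w : R) : a <= b -> 0 <= w ->
  (forall u, a < u -> u <= b -> w <= W u 0) -> Phi a + w * (b - a) <= Phi b.
Proof.
move=> ab w0 hw; rewrite -lee_fin EFinD !PhiE.
have m1 : measurable_fun setT (fun u : R => ((u <= a)%R%:R : R)%:E) by meast.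
have m2 : measurable_fun setT (fun u : R => (((a < u) && (u <= b))%R%:R : R)%:E) by meast.
have -> : (\int[stdnormal]_u ((u <= b)%R%:R : R)%:E = \int[stdnormal]_u
    (((u <= a)%R%:R : R)%:E + (((a < u) && (u <= b))%R%:R : R)%:E))%E.
  apply: eq_integral => u _; rewrite -EFinD; congr EFin.
  case: (leP u a) => ua /=; last by rewrite add0r.
  by rewrite (le_trans ua ab) addr0.
rewrite ge0_integralD; [|by []|by move=> *; rewrite lee_fin|exact: m1|
  by move=> *; rewrite lee_fin|exact: m2].
apply: leeD2l.
rewrite (integral_stdnormal m2); last by move=> u; rewrite lee_fin.
have -> : ((w * (b - a))%:E = \int[leb]_u (w%:E * (((a < u) && (u <= b))%R%:R : R)%:E))%E.
  rewrite ge0_integralZl; [|by []|exact: m2|by move=> *; rewrite lee_fin|by rewrite lee_fin].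
  rewrite EFinM; congr (_ * _)%E.
  transitivity (\int[leb]_u (\1_(`]a, b]) u : R)%:E)%E; last first.
    by apply: eq_integral => u _; rewrite indicE mem_setE in_itv.
  rewrite integral_indic//= setIT lebesgue_measure_itv /= lte_fin.
  by case: (ltgtP a b) ab => // -> _; rewrite subrr.
apply: ge0_le_integralT.
- by apply: emeasurable_funM; [meast|exact: m2].
- by apply: emeasurable_funM; [meast|exact: m2].
- by move=> u; rewrite mule_ge0// lee_fin.
- move=> u; case: (boolP ((a < u) && (u <= b))) => [/andP[au ub]|_].
    by rewrite !mule1 lee_fin hw.
  by rewrite !mule0.
Qed.

(** Half of the step [h] brings [Phi] strictly below [eps]; the other half gains [h / 2] times a
    lower bound of the density, valid as all points involved are within [|Phiinv eps| + 1] of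
    [0]. *)
Lemma Phi_below_quantile (eps h : R) : 0 < eps -> 0 < h -> h <= 1 ->
  Phi (Phiinv eps - h) <= eps - W (`|Phiinv eps| + 1) 0 / 2 * h.
Proof.
move=> e0 h0 h1; set t := Phiinv eps.
have lt1 : Phi (t - h / 2) < eps.
  by apply: Phi_lt_of_lt_Phiinv => //; rewrite -/t ltrBlDr ltrDl divr_gt0.
have ab : t - h <= t - h / 2 by lra.
have := @Phi_increment _ _ (W (`|t| + 1) 0) ab (W_ge0 _ _).
rewrite (_ : t - h / 2 - (t - h) = h / 2); last by field.
move=> H; rewrite lerBrDr (_ : _ / 2 * h = W (`|t| + 1) 0 * (h / 2)); last by field.
apply: le_trans (ltW lt1); apply: H => u u1 u2.
rewrite /W !subr0 ler_wpM2l ?invr_ge0// ler_expR ler_wpM2r ?invr_ge0//.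
rewrite lerN2 -[u ^+ 2]real_normK ?num_real// lerXn2r ?nnegrE ?addr_ge0//.
rewrite ler_norml; have := ler_norm t; have := ler_norm (- t); rewrite normrN; lra.
Qed.

End quantile.

(** * Asymptotics *)

Section asymptotics.
Variable R : realType.
Local Notation I m := (radint R m).

Lemma ln1D_ge_sq (y : R) : - 2^-1 <= y -> y - y ^+ 2 <= ln (1 + y).
Proof.
move=> y2; have [y0|/ltW y0] := leP 0 y.
  by apply: le_trans (ln1D_ge y0); have := sqr_ge0 y; lra.
apply: le_trans (ln1D_ge_neg y2 y0).
have : 0 <= y ^+ 2 * (y + 2^-1) by rewrite mulr_ge0 ?sqr_ge0//; lra.
rewrite mulrDr -exprSr; lra.
Qed.

Lemma sqrt_1D_half_close (q tau : R) :
  `|Num.sqrt (1 + tau ^+ 2 / 2) - Num.sqrt (1 + q ^+ 2 / 2)| <= `|tau ^+ 2 - q ^+ 2| / 4.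
Proof.
have h (x : R) : 1 <= 1 + x ^+ 2 / 2 by rewrite lerDl divr_ge0// sqr_ge0.
have g (x : R) : 1 <= Num.sqrt (1 + x ^+ 2 / 2) by rewrite -[leLHS]sqrtr1 ler_wsqrtr.
have e (x : R) : Num.sqrt (1 + x ^+ 2 / 2) ^+ 2 = 1 + x ^+ 2 / 2.
  by rewrite sqr_sqrtr// (le_trans ler01).
have := g tau; have := g q; have := e tau; have := e q.
set G := Num.sqrt (1 + tau ^+ 2 / 2); set B := Num.sqrt _ => eB eG B1 G1.
have -> : tau ^+ 2 - q ^+ 2 = 2 * ((G - B) * (G + B)).
  have -> : (G - B) * (G + B) = G ^+ 2 - B ^+ 2 by ring.
  by rewrite eB eG; field.
rewrite 2!normrM (ger0_norm (_ : 0 <= 2))// (ger0_norm (_ : 0 <= G + B)); last by lra.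
have := normr_ge0 (G - B); nra.
Qed.

(** The scale in the denominator depends on [tau = q + d / s] itself. The first term of [kap'] pays
    for replacing it by [beta], through [sqrt_1D_half_close]; the second pays for [kap / s] times
    that scale, which is at most [sqrt (1 + 2 q^2)] as [tau <= 2 q]. *)
Lemma quantile_arg_le (q d s t kap r : R) : 0 < q -> 0 < s -> 0 <= r -> r <= s ->
  0 <= kap ->
  let beta := Num.sqrt (1 + q ^+ 2 / 2) in
  let A := beta * `|t| + 1 in
  let kap' := 3 / 4 * q * A * `|t| + Num.sqrt (1 + 2 * q ^+ 2) * kap in
  d = beta * t - kap' / s -> `|d| <= A -> `|d / s| <= q / 2 ->
  ((q + d / s) * r - s * q) / Num.sqrt (1 + (q + d / s) ^+ 2 / 2) <= t - kap / s.
Proof.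
move=> q0 s0 r0 rs k0 beta A kap' dE dA ds.
set tau := q + d / s.
have tau0 : 0 < tau.
  by have := ds; rewrite ler_norml => /andP[]; rewrite /tau; lra.
have tau2 : tau <= 2 * q.
  by have := ds; rewrite ler_norml => /andP[]; rewrite /tau; lra.
have G0 : 0 < Num.sqrt (1 + tau ^+ 2 / 2).
  by rewrite sqrtr_gt0 ltr_pwDl// divr_ge0// sqr_ge0.
rewrite ler_pdivrMr//; set G := Num.sqrt _ in G0 *.
have A0 : 0 <= A by apply: le_trans dA.
have Gm : G <= Num.sqrt (1 + 2 * q ^+ 2).
  rewrite ler_wsqrtr// lerD2l ler_pdivrMr//.
  have : tau ^+ 2 <= (2 * q) ^+ 2 by rewrite lerXn2r// nnegrE; lra.
  lra.
have close : `|G - beta| * `|t| <= 3 / 4 * q * A * `|t| / s.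
  rewrite mulrAC ler_wpM2r//.
  apply: le_trans (sqrt_1D_half_close _ _) _.
  have -> : tau ^+ 2 - q ^+ 2 = d / s * (2 * q + d / s) by rewrite /tau; ring.
  rewrite normrM.
  have h1 : `|d / s| <= A / s.
    by rewrite normrM normfV (gtr0_norm s0) ler_wpM2r// invr_ge0 ltW.
  have h2 : `|2 * q + d / s| <= 3 * q.
    by apply: le_trans (ler_normD _ _) _; rewrite gtr0_norm ?mulr_gt0//; lra.
  have := ler_pM (normr_ge0 _) (normr_ge0 _) h1 h2; lra.
have step1 : tau * r - s * q <= d.
  apply: le_trans (_ : tau * s - s * q <= _); first by rewrite lerD2r ler_pM2l.
  by rewrite /tau mulrDl divfK ?gt_eqF//; lra.
apply: le_trans step1 _; rewrite dE.
have k1 : G * (kap / s) <= Num.sqrt (1 + 2 * q ^+ 2) * kap / s.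
  by rewrite -mulrA ler_wpM2r// divr_ge0// ltW.
have b1 : (beta - G) * t <= `|G - beta| * `|t|.
  by rewrite distrC -normrM ler_norm.
have -> : kap' / s = 3 / 4 * q * A * `|t| / s + Num.sqrt (1 + 2 * q ^+ 2) * kap / s.
  by rewrite /kap' mulrDl.
rewrite [leRHS]mulrC mulrBr; move: k1 b1 close; rewrite mulrBl.
set X := _ * kap / s; set Y := _ * `|t| / s; lra.
Qed.

(** Factor [1 + (q + d / s)^2] as [(1 + q^2) (1 + y)] and use [ln (1 + y) >= y - y^2]: the part of
    [y] linear in [d] is the second-order term of the rate, the part in [d^2] is nonnegative, and
    [|y| <= E0 / s] bounds the loss by a constant. *)
Lemma ln_rate_ge (q d s A : R) : 0 < q -> 0 < s -> `|d| <= A -> `|d / s| <= q / 2 ->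
  3 * q * A / (1 + q ^+ 2) / s <= 2^-1 ->
  s ^+ 2 / 2 * ln (1 + q ^+ 2) + q * s * d / (1 + q ^+ 2)
    - (3 * q * A / (1 + q ^+ 2)) ^+ 2 / 2 <= s ^+ 2 / 2 * ln (1 + (q + d / s) ^+ 2).
Proof.
move=> q0 s0 dA ds; set E0 := 3 * q * A / _ => E2.
have P0 : 0 < 1 + q ^+ 2 by rewrite ltr_pwDl// sqr_ge0.
pose y := (d / s * (2 * q + d / s)) / (1 + q ^+ 2).
have yE : 1 + (q + d / s) ^+ 2 = (1 + q ^+ 2) * (1 + y).
  by rewrite /y; field; rewrite !gt_eqF.
have ny : `|y| <= E0 / s.
  rewrite /y normrM normfV (gtr0_norm P0) /E0 [leRHS]mulrAC ler_wpM2r ?invr_ge0 ?(ltW P0)//.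
  rewrite normrM.
  have h1 : `|d / s| <= A / s.
    by rewrite normrM normfV (gtr0_norm s0) ler_wpM2r// invr_ge0 ltW.
  have h2 : `|2 * q + d / s| <= 3 * q.
    by apply: le_trans (ler_normD _ _) _; rewrite gtr0_norm ?mulr_gt0//; lra.
  have := ler_pM (normr_ge0 _) (normr_ge0 _) h1 h2; lra.
have y2 : - 2^-1 <= y.
  by have := le_trans ny E2; rewrite ler_norml => /andP[].
have y1 : 0 < 1 + y by lra.
rewrite yE lnM ?posrE// mulrDr -addrA lerD2l.
have s2 : 0 <= s ^+ 2 / 2 by rewrite divr_ge0// sqr_ge0.
apply: le_trans (ler_wpM2l s2 (ln1D_ge_sq y2)).
rewrite mulrBr; apply: lerB.
  have -> : s ^+ 2 / 2 * y = q * s * d / (1 + q ^+ 2) + d ^+ 2 / 2 / (1 + q ^+ 2).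
    by rewrite /y; field; rewrite !gt_eqF.
  by rewrite lerDl divr_ge0 ?(ltW P0)// divr_ge0// sqr_ge0.
have : (s * `|y|) ^+ 2 <= E0 ^+ 2.
  have h : s * `|y| <= E0 by rewrite mulrC -ler_pdivlMr.
  by rewrite !expr2 ler_pM// mulr_ge0// ltW.
rewrite exprMn real_normK ?num_real//; lra.
Qed.

(** The factor [(1 + tau^2)^2] is the excess of the exponent [n = p + 5] in the number of codewords
    over the exponent [p + 1] in the cost of a competitor. The 20 is [5 * 4], from [k >= s^2 / 5]
    and [tau >= q / 2]. *)
Lemma competitors_le (K q tau s k : R) : 0 <= K -> 0 < q -> q / 2 <= tau -> tau <= 2 * q ->
  3 <= s -> k = s ^+ 2 - 4 ->
  s * (K / (k * tau ^+ 2) * (1 + tau ^+ 2) ^+ 2) <=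
  20 * K * (1 + 4 * q ^+ 2) ^+ 2 / q ^+ 2 / s.
Proof.
move=> K0 q0 t1 t2 s3 kE.
have s0 : 0 < s by lra.
have q2 : 0 < q ^+ 2 by rewrite exprn_gt0.
have s2 : 0 < s ^+ 2 by rewrite exprn_gt0.
have s9 : 9 <= s ^+ 2 by nra.
have k1 : s ^+ 2 / 5 <= k by rewrite kE; lra.
have tq : q ^+ 2 / 4 <= tau ^+ 2 by nra.
have tq' : tau ^+ 2 <= 4 * q ^+ 2 by nra.
have u : (1 + tau ^+ 2) ^+ 2 <= (1 + 4 * q ^+ 2) ^+ 2.
  by rewrite lerXn2r ?nnegrE; lra.
have kt : s ^+ 2 / 5 * (q ^+ 2 / 4) <= k * tau ^+ 2.
  by apply: ler_pM => //; rewrite divr_ge0// ltW.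
have kt0 : 0 < s ^+ 2 / 5 * (q ^+ 2 / 4) by rewrite mulr_gt0// divr_gt0.
have -> : 20 * K * (1 + 4 * q ^+ 2) ^+ 2 / q ^+ 2 / s =
  s * (K / (s ^+ 2 / 5 * (q ^+ 2 / 4)) * (1 + 4 * q ^+ 2) ^+ 2).
  by field; rewrite !gt_eqF.
rewrite ler_pM2l//; apply: ler_pM => //.
- by rewrite divr_ge0// (le_trans (ltW kt0) kt).
- exact: sqr_ge0.
- by rewrite ler_wpM2l// lef_pV2// posrE (lt_le_trans kt0).
Qed.

End asymptotics.

(** * Choice of the parameters *)

Section large_blocklength.
Variables (R : realType) (eps P : R).
Hypotheses (eps0 : 0 < eps) (P0 : 0 < P).
Local Notation I m := (radint R m).

Lemma exists_code_large : exists S0 C : R, 3 <= S0 /\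
  forall n : nat, S0 <= Num.sqrt n%:R -> exists M : nat,
  [/\ (0 < M)%N, code_exists n M eps P &
    n%:R / 2 * ln (1 + P) +
    Num.sqrt n%:R * (Num.sqrt P * Num.sqrt (1 + P / 2) / (1 + P)) * Phiinv eps
    + ln (Num.sqrt n%:R) - C <= ln M%:R].
Proof.
pose q := Num.sqrt P; have q0 : 0 < q by rewrite sqrtr_gt0.
have q2 : q ^+ 2 = P by rewrite sqr_sqrtr// ltW.
pose t := Phiinv eps; pose beta := Num.sqrt (1 + q ^+ 2 / 2).
pose A := beta * `|t| + 1.
have A1 : 1 <= A by rewrite lerDr mulr_ge0 ?sqrtr_ge0.
have A0 : 0 < A by exact: lt_le_trans ltr01 A1.
pose eta := W (`|t| + 1) 0 / 2.
have eta0 : 0 < eta.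
  rewrite divr_gt0// mulr_gt0 ?expR_gt0// invr_gt0 sqrtr_gt0 mulr_gt0//.
  exact: pi_gt0.
have i3 := radint_gt0 R 3.
(* [D1 / s] will bound the total confusion and [D2 / s] the error of the normal approximation; [kap]
   is such that lowering the quantile by [kap / s] gains exactly [(D1 + D2) / s]. *)
pose D1 := 20 * 300 * (1 + 4 * q ^+ 2) ^+ 2 / q ^+ 2.
have D10 : 0 <= D1.
  by rewrite /D1; pos.
pose D2 := 38 * I 3; have D20 : 0 < D2 by rewrite mulr_gt0.
pose kap := (D1 + D2) / eta.
have kap_gt0 : 0 < kap by rewrite divr_gt0// ltr_wpDl.
have kap0 := ltW kap_gt0.
pose kap' := 3 / 4 * q * A * `|t| + Num.sqrt (1 + 2 * q ^+ 2) * kap.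
have kap'0 : 0 <= kap'.
  rewrite addr_ge0// mulr_ge0 ?sqrtr_ge0// mulr_ge0 ?(ltW A0)//.
  by rewrite mulr_ge0// ltW.
pose E0 := 3 * q * A / (1 + q ^+ 2).
have P1 : 0 < 1 + q ^+ 2 by rewrite q2 addr_gt0.
have E00 : 0 <= E0 by rewrite divr_ge0 ?(ltW P1)// mulr_ge0 ?(ltW A0)// mulr_ge0// ltW.
have Aq0 : 0 <= A / q by rewrite divr_ge0// ltW.
(* Each summand secures one condition: [kap / s] and [kap' / s] at most 1, [|d / s| <= q / 2],
   [E0 / s <= 1/2], and [16 * I 3 <= r] since [r >= s / 2]. *)
exists (3 + kap + kap' + 2 * (A / q) + 2 * E0 + 32 * I 3).
(* The three losses: rounding [z] down to an integer, the shift [kap'] of the quantile, the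
   quadratic remainder of the logarithm. *)
exists (ln 2 + q * kap' / (1 + q ^+ 2) + E0 ^+ 2 / 2).
have i30 := ltW i3; split; first by lra.
move=> n; set s := Num.sqrt _ => hs.
have s3 : 3 <= s by lra.
have s0 : 0 < s by lra.
have s2 : s ^+ 2 = n%:R by rewrite sqr_sqrtr.
have [p nE] : exists p, n = p.+4.+1.
  have : (5 <= n)%N by rewrite -(ler_nat R) -s2; nra.
  by case: n {hs s2 s s3 s0} => [|[|[|[|[|p]]]]] // _; exists p.
pose d := beta * t - kap' / s.
have ks1 : kap' / s <= 1 by rewrite ler_pdivrMr// mul1r; lra.
have ks0 : 0 <= kap' / s by rewrite divr_ge0// ltW.
have dA : `|d| <= A.
  apply: le_trans (ler_normB _ _) _; rewrite normrM (ger0_norm (sqrtr_ge0 _)).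
  by rewrite lerD2l ger0_norm.
have ds : `|d / s| <= q / 2.
  rewrite normrM normfV (gtr0_norm s0) ler_pdivrMr//.
  apply: le_trans dA _; rewrite -ler_pdivrMl ?divr_gt0// invf_div.
  have -> : 2 / q * A = 2 * (A / q) by ring.
  lra.
pose tau := q + d / s.
have /andP[ds1 ds2] : (- (q / 2) <= d / s) && (d / s <= q / 2) by rewrite -ler_norml.
have tau1 : q / 2 <= tau by rewrite /tau; lra.
have tau2 : tau <= 2 * q by rewrite /tau; lra.
have tau0 : 0 < tau by lra.
pose sg := Num.sqrt (1 + tau ^+ 2).
have sg2 : sg ^+ 2 = 1 + tau ^+ 2 by rewrite sqr_sqrtr// addr_ge0// sqr_ge0.
have sg1 : 1 <= sg by rewrite -[leLHS]sqrtr1 ler_wsqrtr// lerDl sqr_ge0.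
have sg0 : 0 < sg by exact: lt_le_trans ltr01 sg1.
pose z := s * sg ^+ n.
have sgn1 : 1 <= sg ^+ n by rewrite exprn_ege1.
have z1 : 1 <= z by rewrite /z; nra.
have z0 : 0 <= z by lra.
have /andP[Mz zM] := truncn_itv z0.
set M := Num.truncn z in Mz zM.
have M0 : (0 < M)%N by rewrite truncn_gt0.
have M1 : 1 <= M%:R :> R by rewrite ler1n.
exists M; split => //.
  rewrite nE; pose r := Num.sqrt (p.+3%:R : R).
  have r2 : r ^+ 2 = s ^+ 2 - 2.
    by rewrite sqr_sqrtr// s2 nE -(natr1 p.+4) -(natr1 p.+3); ring.
  have r0 : 0 <= r by rewrite sqrtr_ge0.
  have rs : r <= s by rewrite -(@ler_pXn2r _ 2)// ?nnegrE ?(ltW s0)// r2; lra.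
  have rs2 : s / 2 <= r.
    rewrite -(@ler_pXn2r _ 2)// ?nnegrE ?divr_ge0 ?(ltW s0)// r2; nra.
  have r_gt0 : 0 < r by apply: lt_le_trans rs2; rewrite divr_gt0.
  have r16 : 16 * I 3 <= r by lra.
  have kE : p.+1%:R = s ^+ 2 - 4 :> R.
    by rewrite s2 nE -(natr1 p.+4) -(natr1 p.+3) -(natr1 p.+2) -(natr1 p.+1); ring.
  have h1 := @mean_atypical_le R p (s * q) tau tau0 r16.
  set F := Phi _ in h1.
  have hF : F <= eps - eta * (kap / s).
    have hk : kap / s <= 1 by rewrite ler_pdivrMr// mul1r; lra.
    have kp : 0 < kap / s by rewrite divr_gt0.
    apply: le_trans (Phi_below_quantile eps0 kp hk); apply: Phi_mono.
    exact: (@quantile_arg_le R q d s t kap r q0 s0 r0 rs kap0 erefl dA ds).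
  (* 19 instead of 18 makes the bound strict, as [code_existsP] requires. *)
  apply: (@code_existsP R p (s * q) tau P M (F + 19 * I 3 / r) eps M0) => //.
  - by rewrite exprMn s2 nE q2.
  - apply: le_lt_trans h1 _; rewrite lte_fin ltrD2l.
    by rewrite ltr_pdivrMr// divfK ?gt_eqF//; lra.
  have B0 : 0 <= 300 / (p.+1%:R * tau ^+ 2) * sg^-1 ^+ p.+1.
    by pos.
  rewrite -/sg.
  have Bz : (M%:R - 1) * (300 / (p.+1%:R * tau ^+ 2) * sg^-1 ^+ p.+1) <= D1 / s.
    apply: le_trans (_ : z * (300 / (p.+1%:R * tau ^+ 2) * sg^-1 ^+ p.+1) <= _).
      by rewrite ler_wpM2r//; lra.
    have C := @competitors_le R 300 q tau s p.+1%:R (ler0n _ _) q0 tau1 tau2 s3 kE.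
    apply: le_trans C.
    rewrite /z nE -[p.+4.+1]addn4 exprD -sg2 -exprM exprVn le_eqVlt.
    apply/orP; left; apply/eqP; set x := sg ^+ p.+1.
    have x0 : x != 0 by rewrite expf_neq0// gt_eqF.
    have k0 : p.+1%:R != 0 :> R by rewrite pnatr_eq0.
    by field; rewrite gt_eqF// nat1r k0.
  have r19 : 19 * I 3 / r <= D2 / s.
    rewrite ler_pdivrMr// [leRHS]mulrAC ler_pdivlMr// /D2.
    move: (ler_wpM2l i30 rs2); set x := I 3; clear; lra.
  have ek : eta * (kap / s) = D1 / s + D2 / s.
    by rewrite /kap; field; rewrite !gt_eqF.
  move: hF Bz r19; rewrite ek.
  set u := D1 / s; set v := D2 / s; set x := (M%:R - 1) * _; set y := _ / r.
  by clear; lra.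
have z_gt0 : 0 < z by lra.
have zM2 : ln z - ln 2 <= ln M%:R.
  rewrite -ln_div ?posrE// ler_ln ?posrE ?divr_gt0 ?ltr0n//.
  rewrite ler_pdivrMr//; move: zM; rewrite -natr1; lra.
have zE : ln z = ln s + s ^+ 2 / 2 * ln (1 + tau ^+ 2).
  rewrite /z lnM ?posrE ?exprn_gt0// lnXn// -sg2 lnXn// s2; congr (_ + _).
  by rewrite -[in LHS]mulr_natl -[in RHS]mulr_natl; field.
have := @ln_rate_ge R q d s A q0 s0 dA ds.
have -> : 3 * q * A / (1 + q ^+ 2) / s <= 2^-1.
  by rewrite -/E0 ler_pdivrMr//; lra.
move=> /(_ isT); rewrite -/E0 -/tau => H.
apply: le_trans zM2; rewrite zE.
have dE : q * s * d / (1 + q ^+ 2) = s * (q * beta / (1 + q ^+ 2)) * t - q * kap' / (1 + q ^+ 2).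
  by rewrite /d; field; rewrite !gt_eqF.
move: H; rewrite dE -s2 -q2 -/q -/beta (_ : Num.sqrt (q ^+ 2) = q); last first.
  by rewrite sqrtr_sqr gtr0_norm.
rewrite -/beta -/t.
set X := s ^+ 2 / 2 * _; set Y := s * _ * t; set Z := q * kap' / _.
set V := s ^+ 2 / 2 * _; lra.
Qed.

End large_blocklength.

(** * Change of base and small blocklengths *)

Section assembly.
Variable R : realType.

Lemma code_exists1 n (eps P : R) : 0 < eps -> 0 < P -> code_exists n 1 eps P.
Proof.
move=> e0 P0; split=> //; exists (fun _ => [tuple 0 | i < n]), (fun _ => setT); split.
- move=> _; rewrite /sqnorm big1 => [|i _]; last by rewrite tnth_mktuple expr0n.
  by rewrite mulr_ge0// ltW.
- by move=> _; exact: measurableT.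
- by move=> i j; rewrite !ord1 eqxx.
- rewrite big_ord1 setCT Wn_gauss; last exact: measurable0.
  rewrite integral0_eq ?mule0 ?lee_fin ?ltW// => z _.
  by rewrite indicE in_set0.
Qed.

Lemma elogb_Mstar_ge n M (b eps P : R) : 1 < b -> code_exists n M eps P ->
  ((logb b M%:R)%:E <= elogb b (Mstar n eps P))%E.
Proof.
move=> b1 cM; have M0 : (0 < M)%N by case: cM.
have : ((M%:R)%:E <= Mstar n eps P)%E by apply: ereal_sup_ubound; exists M.
case: (Mstar n eps P) => [x| |] //=; rewrite ?leey// !lee_fin => Mx.
have M0R : 0 < M%:R :> R by rewrite ltr0n.
rewrite /logb ler_pM2r ?invr_gt0 ?ln_gt0//.
by rewrite ler_ln// posrE (lt_le_trans M0R).
Qed.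

(** Here [s = sqrt n], so [1/2 log n] is [log s]; the root of the dispersion simplifies by
    [P (P + 2) / 2 = P (1 + P / 2)]. *)
Lemma logb_rateE (b P s t c : R) : 1 < b -> 0 < P -> 0 < s ->
  s ^+ 2 * Ccap b P + Num.sqrt (s ^+ 2 * Vdisp b P) * t + 2^-1 * logb b (s ^+ 2) + c =
  (s ^+ 2 / 2 * ln (1 + P) + s * (Num.sqrt P * Num.sqrt (1 + P / 2) / (1 + P)) * t
   + ln s + c * ln b) / ln b.
Proof.
move=> b1 P0 s0; have l0 : 0 < ln b by rewrite ln_gt0.
have P1 : 0 < 1 + P by rewrite addr_gt0.
set w := Num.sqrt P * _ / _.
have w0 : 0 <= w by rewrite divr_ge0 ?mulr_ge0 ?sqrtr_ge0 ?(ltW P1).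
have -> : s ^+ 2 * Vdisp b P = (s * w / ln b) ^+ 2.
  rewrite /Vdisp /logb expRK /w !exprMn !exprVn !sqr_sqrtr ?(ltW P0)//; last first.
    by rewrite addr_ge0// divr_ge0// ltW.
  by field; rewrite !gt_eqF// addrC.
rewrite sqrtr_sqr ger0_norm; last by pos.
by rewrite /Ccap /logb lnXn//; field; rewrite gt_eqF.
Qed.

End assembly.

Theorem theorem1 (R : realType) (b : R) (hb : 1 < b) (eps P : R)
  (heps0 : 0 < eps) (heps1 : eps < 1) (hP : 0 < P) :
  exists c : R, forall n : nat, (0 < n)%N ->
    ((n%:R * Ccap b P + Num.sqrt (n%:R * Vdisp b P) * Phiinv eps
      + 2^-1 * logb b n%:R + c)%:E
     <= elogb b (Mstar n eps P))%E.
Proof.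
have [S0 [C [S3 large]]] := exists_code_large heps0 hP.
have lb : 0 < ln b by rewrite ln_gt0.
pose w := Num.sqrt P * Num.sqrt (1 + P / 2) / (1 + P).
have w0 : 0 <= w by rewrite divr_ge0 ?mulr_ge0 ?sqrtr_ge0// addr_ge0// ltW.
have lP : 0 <= ln (1 + P) by rewrite ln_ge0// lerDl ltW.
have S00 : 0 < S0 by apply: lt_le_trans S3.
(* A bound on the rate for all [s <= S0], using [ln s <= s]: subtracting it makes the claim
   nonpositive there, so that a single codeword is enough. *)
pose A := S0 ^+ 2 / 2 * ln (1 + P) + S0 * w * `|Phiinv eps| + S0.
exists (- (`|A| + `|C|) / ln b) => n n0.
set s := Num.sqrt (n%:R : R).
have s0 : 0 < s by rewrite sqrtr_gt0 ltr0n.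
have s2 : n%:R = s ^+ 2 by rewrite sqr_sqrtr.
have rate M : code_exists n M eps P ->
    s ^+ 2 / 2 * ln (1 + P) + s * w * Phiinv eps + ln s - (`|A| + `|C|) <= ln M%:R ->
    ((n%:R * Ccap b P + Num.sqrt (n%:R * Vdisp b P) * Phiinv eps
      + 2^-1 * logb b n%:R + - (`|A| + `|C|) / ln b)%:E
     <= elogb b (Mstar n eps P))%E.
  move=> cM hM; apply: le_trans (elogb_Mstar_ge hb cM); rewrite lee_fin s2.
  rewrite logb_rateE// -/w /logb ler_pM2r ?invr_gt0//.
  by rewrite divfK ?gt_eqF.
have [sS|/ltW sS] := leP S0 s.
  have [M [M0 cM hM]] := large n sS; apply: (rate M cM).
  move: hM; rewrite -/s s2 -/w.
  have := ler_norm C; have := normr_ge0 A; lra.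
apply: (rate 1%N (code_exists1 n heps0 hP)); rewrite ln1.
have h1 : s ^+ 2 / 2 * ln (1 + P) <= S0 ^+ 2 / 2 * ln (1 + P).
  by rewrite ler_wpM2r// ler_wpM2r ?invr_ge0// lerXn2r ?nnegrE// ltW.
have h2 : s * w * Phiinv eps <= S0 * w * `|Phiinv eps|.
  apply: le_trans (_ : s * w * `|Phiinv eps| <= _).
    by rewrite ler_wpM2l ?ler_norm// mulr_ge0// ltW.
  by rewrite ler_wpM2r// ler_wpM2r.
have h3 : ln s <= S0 by apply: le_trans sS; exact/ltW/ln_sublinear.
have hA : S0 ^+ 2 / 2 * ln (1 + P) + S0 * w * `|Phiinv eps| + S0 <= `|A| := ler_norm A.
have hC := normr_ge0 C; lra.
Qed.
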